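(* Let $N$ be a feed-forward network with layers $C_0,\dots,C_m$, $f\in\mathcal{V}_0(N)$ generic and $L$ a feed-forward lift of $N$. If $L$ is a lift inside $C_j$, where $0<j<m$ and $|C_{j+1}|=1$, then there is a bifurcation branch of $f$ on $L$ which is not lifted from $N$.
   Context: A network $N$ with $k$ edge types is a finite set of cells $C$ together with functions $\sigma_1,\dots,\sigma_k:C\to C$ ($\sigma_i(c)$ is the source of the unique edge of type $i$ targeting $c$); $|N|=|C|$. Networks represented by $(\sigma_i:C\to C)$ and $(\sigma_i':C'\to C')$ are equal if there is a bijection $\varphi:C\to C'$ with $\varphi\circ\sigma_i=\sigma_i'\circ\varphi$ for all $i$. A feed-forward network is a network whose cells can be partitioned into nonempty layers $C_0,\dots,C_m$ such that $\sigma_i(c)=c$ for $c\in C_0$ and all $i$; $\sigma_i(C_j)\subseteq C_{j-1}$ for $1\le j\le m$ and all $i$; and for $0\le j\le m-1$ every $c\in C_j$ equals $\sigma_i(c')$ for some $c'\in C_{j+1}$ and some $i$. Feed-forward networks are assumed connected (as undirected graphs). A coloring is an equivalence relation $\bowtie$ on the cells; it is balanced if $c\bowtie c'$ implies $\sigma_i(c)\bowtie\sigma_i(c')$ for all $i$. The quotient network $N/\bowtie$ has the $\bowtie$-classes as cells and is represented by $\sigma_i^{\bowtie}([c]_{\bowtie})=[\sigma_i(c)]_{\bowtie}$. $L$ is a lift of $N$ if $N=L/\bowtie$ for some balanced coloring $\bowtie$ in $L$. For a feed-forward lift $L$ (layers $C'_0,\dots,C'_n$) of a feed-forward network $N$ (layers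 $C_0,\dots,C_m$), $L$ is a lift inside the layer $C_j$ if $m=n$, $|C'_j|\ne|C_j|$ and $|C'_i|=|C_i|$ for $i\ne j$. $\mathcal{V}(N)$ is the set of smooth $f:\mathbb{R}\times\mathbb{R}^k\times\mathbb{R}\to\mathbb{R}$, $(x_0,x_1,\dots,x_k,\lambda)\mapsto f$, with $f(0,\dots,0,\lambda)=0$ for all $\lambda$; $f_i=\partial f/\partial x_i$ at the origin. $\mathcal{V}_0(N)=\{f\in\mathcal{V}(N): f_0=0\}$. It depends only on $k$, so $\mathcal{V}_0(N)=\mathcal{V}_0(L)$. The vector field is $(f^N(x,\lambda))_c=f(x_c,x_{\sigma_1(c)},\dots,x_{\sigma_k(c)},\lambda)$ on $\mathbb{R}^{|N|}$. ''Generic'' means: there is an open dense subset $O$ of the space of possible values of the first and second order partial derivatives at the origin of elements of the class, such that the statement holds for every $f$ in the class whose derivatives lie in $O$. A domain is an interval $]-\lambda_0,0]$, $]-\lambda_0,\lambda_0[$ or $[0,\lambda_0[$ with $\lambda_0>0$. An equilibrium branch of $f$ on $N$ is a function $b:D\to\mathbb{R}^{|N|}$ on a domain $D$ with $b(0)=0$ and $f^N(b(\lambda),\lambda)=0$ for all $\lambda\in D$, which is smooth if $D=]-\lambda_0,\lambda_0[$, and continuous on $D$ and smooth on $D\setminus\{0\}$ if $D$ is one-sided. Branches are taken as germs: $b_1:D_1\to\mathbb{R}^{|N|}$ and $b_2:D_2\to\mathbb{R}^{|N|}$ are related if there is an open neighborhood $U$ of $0$ with $U\cap D_1\cap D_2\ne\{0\}$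 and $b_1=b_2$ on $U\cap D_1\cap D_2$; germ equivalence is the transitive closure, and equivalent branches are identified. The bifurcation branches are the equilibrium branches different from the trivial branch $0$. A bifurcation branch $b$ of $f$ on $L$ is lifted from $N$ if there is a balanced coloring $\bowtie$ in $L$ with $N=L/\bowtie$ and $b\in\Delta_{\bowtie}$, i.e. $b(\lambda)\in\Delta_{\bowtie}=\{x: c\bowtie d\Rightarrow x_c=x_d\}$ for all $\lambda$ in the domain near $0$. *)

(* Defs.v *)
(* MathComp and MathComp-Analysis, over an arbitrary R : realType. *)
From mathcomp Require Import all_boot all_order all_algebra generic_quotient.
From mathcomp Require Import all_classical all_reals all_analysis.
From Stdlib Require Import Relation_Operators.

Set Implicit Arguments.
Unset Strict Implicit.
Unset Printing Implicit Defensive.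

Import Order.TTheory GRing.Theory Num.Theory.
Import numFieldNormedType.Exports.

Local Open Scope classical_set_scope.
Local Open Scope ring_scope.

Record network (k : nat) := Network {
  cells :> finType;
  source : 'I_k -> cells -> cells
}.

Definition network_eq (k : nat) (N N' : network k) : Prop :=
  exists2 phi : N -> N', bijective phi &
    forall (i : 'I_k) (c : N), phi (source i c) = source i (phi c).

Definition adjacent (k : nat) (N : network k) : rel N :=
  fun c d => [exists i : 'I_k, (source i c == d) || (source i d == c)].

Definition connected_network (k : nat) (N : network k) : Prop :=
  forall c d : N, connect (@adjacent k N) c d.

(* Only the members [C j] with [j <= m] of the family are relevant. *)
Record feed_forward (k : nat) (N : network k) (m : nat) (C : nat -> {set N})
    : Prop := FeedForward {
  ff_connected : connected_network N;
  ff_nonempty : forall j, (j <= m)%N -> C j != finset.set0;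
  ff_disjoint : forall j j', (j <= m)%N -> (j' <= m)%N -> j != j' ->
    C j :&: C j' = finset.set0;
  ff_cover : forall c : N, exists2 j, (j <= m)%N & c \in C j;
  ff_fixed : forall c i, c \in C 0%N -> source i c = c;
  ff_source : forall j c i, (j < m)%N -> c \in C j.+1 -> source i c \in C j;
  ff_feeds : forall j c, (j < m)%N -> c \in C j ->
    exists2 c', c' \in C j.+1 & exists i, c = source i c'
}.

Definition balanced (k : nat) (N : network k) (bt : equiv_rel N) : Prop :=
  forall (c d : N) (i : 'I_k), bt c d -> bt (source i c) (source i d).

(* The source maps are evaluated on canonical representatives; they satisfy
   source i [c] = [source i c] when bt is balanced. The wrapper [quot_type]
   carries the finType structure of the quotient. *)
Definition quotient_network (k : nat) (N : network k) (bt : equiv_rel N)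
    : network k :=
  @Network k (quot_type {eq_quot bt}%qT)
    (fun i q => \pi_{eq_quot bt}%qT (source i (repr q))).

Definition is_lift (k : nat) (L N : network k) : Prop :=
  exists2 bt : equiv_rel L, balanced bt & network_eq N (quotient_network bt).

Definition lift_inside (k : nat) (L : network k) (n : nat) (C' : nat -> {set L})
    (N : network k) (m : nat) (C : nat -> {set N}) (j : nat) : Prop :=
  [/\ is_lift L N, m = n, #|C' j| <> #|C j| &
      forall i, (i <= m)%N -> i <> j -> #|C' i| = #|C i|].

Section Smooth.
Variable R : realType.

Definition partial (n : nat) (a : 'I_n) (f : 'rV[R]_n -> R) : 'rV[R]_n -> R :=
  fun x => 'D_(delta_mx 0 a) f x.

Definition iter_partial (n : nat) (s : seq 'I_n) (f : 'rV[R]_n -> R) :=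
  foldr (@partial n) f s.

Definition smooth (n : nat) (f : 'rV[R]_n -> R) : Prop :=
  forall s : seq 'I_n, continuous (iter_partial s f) /\
    forall a x, derivable (iter_partial s f) x (delta_mx 0 a).

(* To be used with U open. *)
Definition smooth_on (U : set R) (g : R -> R) : Prop :=
  forall (n : nat) (t : R), U t -> derivable (derive1n n g) t 1.

End Smooth.

Section VectorFields.
Variables (R : realType) (k : nat).

(* The point (x_0, x_1, ..., x_k, lambda) of R x R^k x R. *)
Definition point (x0 : R) (x : 'I_k -> R) (lam : R) : 'rV[R]_(1 + k + 1) :=
  row_mx (row_mx (const_mx x0) (\row_i x i)) (const_mx lam).

(* The index of the variable x_0. *)
Definition var0 : 'I_(1 + k + 1) := lshift 1 (lshift k ord0).

Definition V : set ('rV[R]_(1 + k + 1) -> R) :=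
  [set f | smooth f /\ forall lam, f (point 0 (fun=> 0) lam) = 0].

Definition V0 : set ('rV[R]_(1 + k + 1) -> R) :=
  [set f | V f /\ partial var0 f 0 = 0].

Definition jet2 (f : 'rV[R]_(1 + k + 1) -> R)
    : 'rV[R]_(1 + k + 1) * 'M[R]_(1 + k + 1) :=
  (\row_a partial a f 0, \matrix_(a, b) partial a (partial b f) 0).

(* O is relatively open and dense in the set [jet2 @` F] of jets realised by
   the class F. *)
Definition generically (F P : set ('rV[R]_(1 + k + 1) -> R)) : Prop :=
  exists O : set ('rV[R]_(1 + k + 1) * 'M[R]_(1 + k + 1)),
  [/\ (exists2 U, open U & O = U `&` (jet2 @` F)),
      jet2 @` F `<=` closure O &
      forall f, F f -> O (jet2 f) -> P f].

Definition vector_field (f : 'rV[R]_(1 + k + 1) -> R) (N : network k)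
    (x : N -> R) (lam : R) : N -> R :=
  fun c => f (point (x c) (fun i => x (source i c)) lam).

Definition branch_regular (N : network k) (D : set R) (b : R -> N -> R)
    : Prop :=
  exists2 l : R, 0 < l &
    (D = `]- l, l[%classic /\ forall c, smooth_on D (b ^~ c)) \/
    ((D = `]- l, 0]%classic \/ D = `[0, l[%classic) /\
     forall c, {within D, continuous (b ^~ c)} /\
               smooth_on (D `\ 0) (b ^~ c)).

(* The values of [bval] outside [bdom] are irrelevant. *)
Record equilibrium_branch (f : 'rV[R]_(1 + k + 1) -> R) (N : network k) :=
  EquilibriumBranch {
  bdom : set R;
  bval : R -> N -> R;
  bregular : branch_regular bdom bval;
  bzero : forall c, bval 0 c = 0;
  bequilibrium : forall lam, bdom lam ->
    forall c, vector_field f (bval lam) lam c = 0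
}.

Section Branches.
Variables (f : 'rV[R]_(1 + k + 1) -> R) (N : network k).
Implicit Types b : equilibrium_branch f N.

Definition branch_related b1 b2 : Prop :=
  exists U : set R, [/\ open U, U 0,
    U `&` bdom b1 `&` bdom b2 <> [set 0] &
    forall lam, U lam -> bdom b1 lam -> bdom b2 lam ->
      bval b1 lam =1 bval b2 lam].

Definition germ_eq : equilibrium_branch f N -> equilibrium_branch f N -> Prop :=
  clos_trans (equilibrium_branch f N) branch_related.

Definition is_trivial b : Prop :=
  exists2 b0, germ_eq b b0 & forall lam, bdom b0 lam -> forall c, bval b0 lam c = 0.

Definition bifurcation_branch b : Prop := ~ is_trivial b.

(* b(lambda) lies in the polydiagonal of bt for lambda in the domain near 0. *)
Definition in_polydiagonal b (bt : equiv_rel N) : Prop :=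
  \forall lam \near (0 : R), bdom b lam ->
    forall c d : N, bt c d -> bval b lam c = bval b lam d.

End Branches.

Definition lifted_from (f : 'rV[R]_(1 + k + 1) -> R) (L N : network k)
    (b : equilibrium_branch f L) : Prop :=
  exists bt : equiv_rel L,
    [/\ balanced bt, network_eq N (quotient_network bt) & in_polydiagonal b bt].

End VectorFields.

Arguments V0 R k : clear implicits.
Arguments V R k : clear implicits.

(* Main.v *)
(** In a network of the given shape put every layer below [j] to zero. In layer
[j] the equation becomes [f(x, 0, ..., 0, lambda) = 0], which has, besides [0], a
transcritical branch [s(lambda)]; let exactly one cell [c0] follow [s] and the
others stay at [0]. The single cell of layer [j + 1] then solves
[f(x, ..., lambda) = 0] with inputs [s] or [0], a square-root type equation, and
all higher layers can be solved synchronously layer by layer. As [f_00 <> 0], each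
equation is strictly convex or concave in [x], so it has a unique small zero of
prescribed sign as soon as the sign of [lambda], resp. of the input, makes the
left-hand side at [x = 0] decrease or have the sign opposite to [f_00]; this zero
is smooth by implicit differentiation.
The quotient maps from the lift to [N] all collapse the same pair of cells in
layer [j]; choosing [c0] in that pair gives a branch that is not lifted.
Nontriviality as a germ follows from the lower bound [kap * |lambda| <= |s|],
which survives the passage to related branches. *)

Require Import Defs.
From mathcomp Require Import all_boot all_order all_algebra.
From mathcomp Require Import generic_quotient zify ring lra.
From mathcomp Require Import all_classical all_reals all_analysis.

Set Implicit Arguments.
Unset Strict Implicit.
Unset Printing Implicit Defensive.

Import Order.TTheory GRing.Theory Num.Theory.
Import numFieldNormedType.Exports.

Local Open Scope ring_scope.
Local Open Scope classical_set_scope.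

Local Notation point := Defs.point.

(** * Partial derivatives *)

(** A square root is real only for one sign of its argument, so the signs are prescribed before
    anything is solved. The sum of the f_i over all edge types dictates the sign of the inputs of
    the synchronous layers. The sum over [J], the types along which the single cell of layer j + 1
    sees c0, dictates the sign of s. The sign of f_0lambda then decides on which side of 0 the
    parameter lambda runs. This works because every layer solution exists with either sign, and it
    is why the branch is one-sided. The set [J] depends on the lift, whereas the generic set must be
    fixed before the lift. Hence, besides f_00 and f_0lambda, the sums of the f_i over all nonempty
    sets of types are required to be nonzero. The collapsed pair is common to all quotient maps
    because each of them sends the single cell of layer j + 1 of L to that of N, and the edges at
    the latter are fixed by N alone. *)

Section MeanValue.
Variable R : realType.

Lemma mean_value_itv (g dg : R -> R) (a b : R) : a < b ->
  (forall x : R, is_derive x (1 : R) g (dg x)) ->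
  exists2 c, a < c < b & g b - g a = dg c * (b - a).
Proof.
move=> ab dgP.
have [|c] := @MVT R g dg a b ab (fun x _ => dgP x).
  apply: continuous_subspaceT => x; apply: differentiable_continuous.
  by have [/derivable1_diffP] := dgP x.
by rewrite in_itv/=; exists c.
Qed.

Lemma mean_value (g dg : R -> R) (a b : R) :
  (forall x : R, is_derive x (1 : R) g (dg x)) ->
  exists2 c, `|c - a| <= `|b - a| & g b - g a = dg c * (b - a).
Proof.
move=> dgP; have [ab|ba|->] := ltgtP a b.
- have [c /andP[ac cb] gE] := mean_value_itv ab dgP; exists c => //.
  by rewrite !gtr0_norm ?subr_gt0 // lerD2r ltW.
- have [c /andP[bc ca] gE] := mean_value_itv ba dgP; exists c.
    by rewrite !ltr0_norm ?subr_lt0 // lerN2 lerD2r ltW.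
  by rewrite -(opprB (g a)) gE -mulrN opprB.
- by exists b => //; rewrite !subrr mulr0.
Qed.

Lemma is_derive_line n (F : 'rV[R]_n -> R) (z v : 'rV[R]_n) (t : R) :
  derivable F (t *: v + z) v ->
  is_derive t 1 (fun h : R => F (h *: v + z)) ('D_v F (t *: v + z)).
Proof.
move=> dF.
have E : (fun h : R => h^-1 *: (((fun h => F (h *: v + z)) \o shift t) (h *: 1)
           - F (t *: v + z))) =
         (fun h => h^-1 *: ((F \o shift (t *: v + z)) (h *: v)
           - F (t *: v + z))).
  apply/funext => h /=; congr (_ *: (F _ - _)).
  by rewrite scalerDl -addrA -[h *: 1]/(h * 1) mulr1.
by split; [rewrite /derivable E | rewrite /derive E].
Qed.

End MeanValue.

Section Caratheodory.
Variables (R : realType) (n : nat).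
Implicit Types (F : 'rV[R]_n -> R) (x z d : 'rV[R]_n).

Lemma smooth_partial F a : smooth F -> smooth (partial a F).
Proof.
move=> sF s.
by have := sF (rcons s a); rewrite /iter_partial foldr_rcons.
Qed.

Lemma smooth_derivable F a x : smooth F -> derivable F x (delta_mx 0 a).
Proof. by move=> sF; have [_] := sF [::]; apply. Qed.

Lemma smooth_continuous F : smooth F -> continuous F.
Proof. by move=> sF; have [] := sF [::]. Qed.

Lemma mx_entry_le (m p : nat) (M : 'M[R]_(m, p)) i j : `|M i j| <= `|M|.
Proof.
rewrite [leRHS]/Num.Def.normr/= mx_normrE.
exact: (le_bigmax _ (fun ij : 'I_m * 'I_p => `|M ij.1 ij.2|) (i, j)).
Qed.

Lemma norm_delta_mx_le (a : 'I_n) : `|delta_mx 0 a : 'rV[R]_n| <= 1.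
Proof.
rewrite -[leLHS]/(mx_norm _) mx_normrE; apply: bigmax_le => // -[i j] _ /=.
by rewrite mxE normr_nat lern1 leq_b1.
Qed.

(** [smooth] speaks of partial derivatives only, so the coordinates are changed one at a time and
    the mean value theorem is applied to each change. Every point met on the way stays within the
    sum of the increments. *)
Lemma telescope_partial F z d (s : seq 'I_n) : uniq s -> smooth F ->
  exists q : 'I_n -> R,
    F (z + \sum_(a <- s) d 0 a *: delta_mx 0 a) - F z
      = \sum_(a <- s) q a * d 0 a /\
    forall a, a \in s -> exists2 xi,
      `|xi - z| <= \sum_(b <- s) `|d 0 b| & q a = partial a F xi.
Proof.
move=> + sF; elim: s => [_|a s IH /= /andP[as_ us]].
  by exists (fun=> 0); split => //; rewrite !big_nil addr0 subrr.
have [q [qE qP]] := IH us.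
set y := z + \sum_(b <- s) d 0 b *: delta_mx 0 b in qE.
have [c cd cE] := @mean_value R (fun h => F (h *: delta_mx 0 a + y)) _ 0 (d 0 a)
   (fun t => is_derive_line (smooth_derivable sF)).
exists (fun b => if b == a then partial a F (c *: delta_mx 0 a + y) else q b).
split.
  rewrite big_cons [in RHS]big_cons eqxx.
  have -> : \sum_(b <- s) (if b == a then partial a F (c *: delta_mx 0 a + y)
       else q b) * d 0 b = \sum_(b <- s) q b * d 0 b.
    by apply: eq_big_seq => b bs; case: eqVneq => // ba; rewrite -ba bs in as_.
  move: cE; rewrite -qE scale0r add0r subr0 /partial => <-.
  by rewrite [RHS]addrA subrK /y addrCA.
have le_y : `|y - z| <= \sum_(b <- s) `|d 0 b|.
  rewrite /y addrAC subrr add0r.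
  apply: le_trans (ler_norm_sum _ _ _) _; apply: ler_sum => b _.
  by rewrite normrZ ler_piMr // norm_delta_mx_le.
move=> b; rewrite inE big_cons; case: eqVneq => [-> _|ba /= bs].
  exists (c *: delta_mx 0 a + y) => //.
  rewrite -addrA; apply: le_trans (ler_normD _ _) _; apply: lerD => //.
  rewrite normrZ; apply: le_trans (ler_piMr _ (norm_delta_mx_le _)) _ => //.
  by rewrite !subr0 in cd.
have [xi xi1 xi2] := qP _ bs; exists xi => //.
by apply: le_trans xi1 _; rewrite lerDr.
Qed.

(* Hadamard's form of differentiability: the incremental quotients [q] serve
   both for the chain rule and for the implicit function theorem. *)
Lemma caratheodory F x : smooth F ->
  exists q : 'rV[R]_n -> 'I_n -> R,
    (forall y, F y - F x = \sum_a q y a * (y 0 a - x 0 a)) /\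
    (forall a, q y a @[y --> x] --> partial a F x).
Proof.
move=> sF.
have /choice[q qP] (y : 'rV[R]_n) := telescope_partial x (y - x)
  (index_enum_uniq 'I_n) sF.
exists q; split.
  move=> y; have [+ _] := qP y.
  rewrite (_ : \sum_(a <- _) _ = y - x); last exact/esym/row_sum_delta.
  rewrite [x + _]addrC subrK => ->.
  by apply: eq_bigr => a _; rewrite !mxE.
move=> a.
apply/(@cvgrPdist_lt _ _ _ _ (nbhs_filter x)) => e e0.
have cF : {for x, continuous (partial a F)}.
  by apply: smooth_continuous; exact: smooth_partial.
have := (@cvgrPdist_lt _ _ _ _ (nbhs_filter x) _ _).1 cF e e0.
rewrite -nbhs_nearE => /nbhs_ballP[r /= r0 rP].
have n0 : 0 < n%:R + 1 :> R by rewrite ltr_wpDl.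
(* The n increments are each at most |x - y|; the added 1 keeps the denominator positive when n =
   0. *)
apply/nbhs_ballP; exists (r / (n%:R + 1)); first exact: divr_gt0.
move=> y; rewrite -ball_normE /= => yx.
have [_ /(_ a (mem_index_enum _))[xi xi1 ->]] := qP y.
apply: rP; rewrite -ball_normE /= distrC; apply: le_lt_trans xi1 _.
apply: (@le_lt_trans _ _ (\sum_(b < n) `|x - y|)).
  apply: ler_sum => b _; rewrite distrC; exact: mx_entry_le.
rewrite sumr_const card_ord -[_ *+ _]mulr_natl.
apply: (@le_lt_trans _ _ ((n%:R + 1) * `|x - y|)).
  by rewrite ler_wpM2r // lerDl.
by rewrite mulrC -ltr_pdivlMr.
Qed.

End Caratheodory.

Section Curves.
Variables (R : realType) (n : nat).
Implicit Types (F : 'rV[R]_n -> R) (gam : R -> 'rV[R]_n).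

(** This is the shape that the argument takes in the definition of [derivable]. *)
Lemma cvg_quotient_shift (t : R) : h *: (1 : R) + t @[h --> 0^'] --> t.
Proof.
have c : h *: (1 : R) + t @[h --> 0] --> 0 *: (1 : R) + t.
  by apply: cvgD; [apply: cvgZ; [exact: cvg_id | exact: cvg_cst] | exact: cvg_cst].
rewrite scale0r add0r in c.
by apply: cvg_trans c; apply: cvg_app; exact: cvg_within.
Qed.

Lemma continuous_curve gam t :
  (forall a, derivable (fun s => gam s 0 a) t 1) -> {for t, continuous gam}.
Proof.
move=> dg; have /derivable1_diffP/differentiable_continuous // :
  derivable gam t 1.
by apply/derivable_mxP => i a; rewrite ord1.
Qed.

Lemma chain_rule F gam (t : R) : smooth F ->
  (forall a, derivable (fun s => gam s 0 a) t 1) ->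
  is_derive t (1 : R) (F \o gam)
    (\sum_a partial a F (gam t) * derive1 (fun s => gam s 0 a) t).
Proof.
move=> sF dg; have [q [qE qc]] := caratheodory (gam t) sF.
have gc : gam (h *: 1 + t) @[h --> 0^'] --> gam t.
  exact: cvg_comp (@cvg_quotient_shift t) (continuous_curve dg).
suff H : h^-1 *: (((F \o gam) \o shift t) (h *: 1) - (F \o gam) t) @[h --> 0^']
    --> \sum_a partial a F (gam t) * derive1 (fun s => gam s 0 a) t.
  by split; [exact: cvgP H | exact: cvg_lim H].
rewrite (_ : (fun h => _) = fun h => \sum_a q (gam (h *: 1 + t)) a *
   (h^-1 *: ((fun s => gam s 0 a) (h *: 1 + t) - gam t 0 a))); last first.
  apply/funext => h /=; rewrite qE scaler_sumr; apply: eq_bigr => a _.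
  by rewrite scalerAr.
apply: cvg_big => [|a _]; first exact: add_continuous.
apply: cvgM; first exact: (cvg_comp _ _ gc (qc a)).
by rewrite derive1E; have := dg a.
Qed.

(** Of the unknown coordinate only continuity is assumed. The identity of [caratheodory] reads 0 =
    sum of q_a times the increments of the coordinates; divided by h and solved for the quotient at
    a0, it has a limit because q_a0 tends to a nonzero number. *)
Lemma implicit_derive F gam (a0 : 'I_n) (t : R) : smooth F ->
  {for t, continuous gam} -> (\forall s \near t, F (gam s) = 0) ->
  partial a0 F (gam t) != 0 ->
  (forall a, a != a0 -> derivable (fun s => gam s 0 a) t 1) ->
  is_derive t (1 : R) (fun s => gam s 0 a0)
    (- (\sum_(a | a != a0) partial a F (gam t) * derive1 (fun s => gam s 0 a) t)
       / partial a0 F (gam t)).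
Proof.
move=> sF cg F0 nz dg; have [q [qE qc]] := caratheodory (gam t) sF.
have gc : gam (h *: 1 + t) @[h --> 0^'] --> gam t.
  exact: cvg_comp (@cvg_quotient_shift t) cg.
have qgc a : q (gam (h *: 1 + t)) a @[h --> 0^'] --> partial a F (gam t).
  exact: (cvg_comp _ _ gc (qc a)).
set L := (X in is_derive _ _ _ X).
suff H : h^-1 *: ((fun s => gam s 0 a0) (h *: 1 + t) - gam t 0 a0) @[h --> 0^']
    --> L.
  by split; [exact: cvgP H | exact: cvg_lim H].
have : - (\sum_(a | a != a0) q (gam (h *: 1 + t)) a *
   (h^-1 *: ((fun s => gam s 0 a) (h *: 1 + t) - gam t 0 a)))
   / q (gam (h *: 1 + t)) a0 @[h --> 0^'] --> L.
  apply: cvgM; last exact: cvgV.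
  apply: cvgN; apply: cvg_big => [|a aa0]; first exact: add_continuous.
  by apply: cvgM => //; rewrite derive1E; have := dg _ aa0.
apply: cvg_trans; apply: near_eq_cvg.
have q0 := cvgr_neq0 _ (qgc a0) nz.
have Fh : \forall h \near (0 : R)^', F (gam (h *: 1 + t)) = 0.
  exact: (@cvg_quotient_shift t _ F0).
near=> h.
have := qE (gam (h *: 1 + t)).
rewrite (near Fh h) // (nbhs_singleton F0) subrr (bigD1 a0) //= => /esym/eqP.
rewrite addrC addr_eq0 => /eqP E.
under eq_bigr do rewrite -scalerAr.
rewrite -scaler_sumr E scalerN opprK -scalerAl [q _ _ * _]mulrC mulfK //.
by near: h; exact: q0.
Unshelve. all: by end_near. Qed.

End Curves.

(** * Smooth curves and implicit differentiation *)

Section TimesDerivable.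
Variable R : realType.

(** The derivative is taken on the inside, so that closure under an operation at order p + 1 follows
    from closure at order p applied to the formula for the derivative. *)
Fixpoint times_derivable (p : nat) (U : set R) (g : R -> R) : Prop :=
  if p is p'.+1 then
    (forall t, U t -> derivable g t (1 : R)) /\ times_derivable p' U (derive1 g)
  else True.

Lemma smooth_onP (U : set R) g :
  smooth_on U g <-> forall p, times_derivable p U g.
Proof.
split=> [sg p|H p].
  elim: p g sg => //= p IH g sg; split=> [t Ut|]; first exact: (sg 0%N).
  by apply: IH => r t Ut; rewrite -derive1Sn; exact: sg.
elim: p g H => [|p IH] g H t Ut; first by have [dg _] := H 1%N; exact: dg.
by rewrite derive1Sn; apply: IH => // r; have [] := H r.+1.
Qed.

Lemma times_derivableW p U g : times_derivable p.+1 U g -> times_derivable p U g.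
Proof. by elim: p g => //= p IH g [dg [dg' H]]; split=> //; exact: IH. Qed.

Lemma times_derivable_sub p (U W : set R) g : U `<=` W ->
  times_derivable p W g -> times_derivable p U g.
Proof.
move=> UW; elim: p g => //= p IH g [dg dg']; split; last exact: IH.
by move=> t /UW; exact: dg.
Qed.

Variable U : set R.
Hypothesis openU : open U.

Lemma near_open t : U t -> \forall s \near t, U s.
Proof. by move=> Ut; apply: open_nbhs_nbhs. Qed.

Lemma times_derivable_ext p g h : (forall t, U t -> g t = h t) ->
  times_derivable p U g -> times_derivable p U h.
Proof.
elim: p g h => //= p IH g h gh [dg dg']; split=> [t Ut|].
  apply: near_eq_derivable (dg t Ut); near=> s; apply: gh; near: s.
  exact: near_open.
apply: IH dg' => t Ut; rewrite !derive1E; apply: near_eq_derive.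
by near=> s; apply: gh; near: s; exact: near_open.
Unshelve. all: by end_near. Qed.

Lemma times_derivable_cst p (c : R) : times_derivable p U (cst c).
Proof.
elim: p c => //= p IH c; split=> [t _|]; first exact: derivable_cst.
apply: times_derivable_ext (IH 0) => t _.
by rewrite derive1_cst.
Qed.

Lemma times_derivable_id p : times_derivable p U id.
Proof.
case: p => //= p; split=> [t _|]; first exact: derivable_id.
apply: times_derivable_ext (times_derivable_cst p 1) => t _.
by rewrite derive1_id.
Qed.

Lemma times_derivableD p g h : times_derivable p U g -> times_derivable p U h ->
  times_derivable p U (fun t => g t + h t).
Proof.
elim: p g h => //= p IH g h [dg dg'] [dh dh']; split=> [t Ut|].
  by apply: derivableD; [exact: dg | exact: dh].
apply: times_derivable_ext (IH _ _ dg' dh') => t Ut.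
by rewrite !derive1E deriveD; [|exact: dg | exact: dh].
Qed.

Lemma times_derivableM p g h : times_derivable p U g -> times_derivable p U h ->
  times_derivable p U (fun t => g t * h t).
Proof.
elim: p g h => //= p IH g h [dg dg'] [dh dh']; split=> [t Ut|].
  by apply: derivableM; [exact: dg | exact: dh].
have H := times_derivableD (IH _ _ dg' (@times_derivableW p U h (conj dh dh')))
  (IH _ _ (@times_derivableW p U g (conj dg dg')) dh').
apply: times_derivable_ext H => t Ut.
rewrite !derive1E deriveM; [|exact: dg | exact: dh].
by rewrite addrC; congr (_ + _); rewrite mulrC.
Qed.

Lemma times_derivableV p g : (forall t, U t -> g t != 0) ->
  times_derivable p U g -> times_derivable p U (fun t => (g t)^-1).
Proof.
move=> g0; elim: p => //= p IH [dg dg']; split=> [t Ut|].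
  by apply: derivableV; [exact: g0 | exact: dg].
have Hg := IH (@times_derivableW p U g (conj dg dg')).
have H := times_derivableM (times_derivable_cst p (-1))
  (times_derivableM dg' (times_derivableM Hg Hg)).
apply: times_derivable_ext H => t Ut.
rewrite !derive1E deriveV; [|exact: g0 | exact: dg].
by rewrite /GRing.scale/= mulN1r expr2 invfM mulNr [in RHS]mulrC.
Qed.

Lemma times_derivable_sum p (I : Type) (r : seq I) (P : pred I) (g : I -> R -> R) :
  (forall i, P i -> times_derivable p U (g i)) ->
  times_derivable p U (fun t => \sum_(i <- r | P i) g i t).
Proof.
move=> H; elim: r => [|i r IH].
  by apply: times_derivable_ext (times_derivable_cst p 0) => t _; rewrite big_nil.
have [Pi|nPi] := boolP (P i); last first.
  by apply: times_derivable_ext IH => t _; rewrite big_cons (negbTE nPi).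
apply: times_derivable_ext (times_derivableD (H i Pi) IH) => t _.
by rewrite big_cons Pi.
Qed.

Section Compositions.
Variables (n : nat) (gam : R -> 'rV[R]_n).
Let coord a := fun s => gam s 0 a.

Lemma times_derivable_comp p F : smooth F ->
  (forall a, times_derivable p U (coord a)) -> times_derivable p U (F \o gam).
Proof.
elim: p F => //= p IH F sF H.
have dg t : U t -> forall a, derivable (coord a) t 1.
  by move=> Ut a; have [dg _] := H a; exact: dg.
split=> [t Ut|]; first by have [] := chain_rule sF (dg t Ut).
have D : times_derivable p U (fun t =>
    \sum_a partial a F (gam t) * derive1 (coord a) t).
  apply: times_derivable_sum => a _; apply: times_derivableM.
    apply: IH; first exact: smooth_partial.
    by move=> b; exact: times_derivableW (H b).
  by have [] := H a.
apply: times_derivable_ext D => t Ut.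
by rewrite [RHS]derive1E; have [_ ->] := chain_rule sF (dg t Ut).
Qed.

(** Bootstrapping: the derivative of the unknown coordinate is a quotient of expressions in all
    coordinates and in the derivatives of the known ones. If the unknown is p times derivable, so is
    its derivative. *)
Lemma implicit_times_derivable F (a0 : 'I_n) : smooth F ->
  (forall t, U t -> {for t, continuous gam}) ->
  (forall t, U t -> F (gam t) = 0) ->
  (forall t, U t -> partial a0 F (gam t) != 0) ->
  (forall p a, a != a0 -> times_derivable p U (coord a)) ->
  forall p, times_derivable p U (coord a0).
Proof.
move=> sF cg F0 nz H.
have D t : U t -> is_derive t (1 : R) (coord a0)
    (- (\sum_(a | a != a0) partial a F (gam t) * derive1 (coord a) t)
       / partial a0 F (gam t)).
  move=> Ut; apply: implicit_derive => //; first exact: cg.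
  - by near=> s; apply: F0; near: s; exact: near_open.
  - exact: nz.
  - by move=> a aa0; have [dg _] := H 1%N a aa0; exact: dg.
elim=> //= p IH; split=> [t Ut|]; first by have [] := D t Ut.
have Hp a : times_derivable p U (coord a).
  by have [->|aa0] := eqVneq a a0; [exact: IH | exact: H].
have E : times_derivable p U (fun t => -1 * (\sum_(a | a != a0)
    partial a F (gam t) * derive1 (coord a) t) * (partial a0 F (gam t))^-1).
  apply: times_derivableM; last first.
    apply: times_derivableV => //.
    by apply: times_derivable_comp => //; exact: smooth_partial.
  apply: times_derivableM; first exact: times_derivable_cst.
  apply: times_derivable_sum => a aa0; apply: times_derivableM.
    by apply: times_derivable_comp => //; exact: smooth_partial.
  by have [] := H p.+1 a aa0.
apply: times_derivable_ext E => t Ut.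
by rewrite [RHS]derive1E; have [_ ->] := D t Ut; rewrite mulN1r.
Unshelve. all: by end_near. Qed.

End Compositions.
End TimesDerivable.

(** * Solving one equation *)

Section Convexity.
Variable R : realType.

(** Between 0 and x the function does not decrease overall, so [dphi] is nonnegative somewhere
    there. As [dphi] increases strictly, it is positive from x on. *)
Lemma convex_sign (phi dphi ddphi : R -> R) (ep x : R) :
  (forall y : R, is_derive y (1 : R) phi (dphi y)) ->
  (forall y : R, is_derive y (1 : R) dphi (ddphi y)) ->
  (forall y, 0 <= y <= ep -> 0 < ddphi y) ->
  phi 0 <= 0 -> 0 < x <= ep -> 0 <= phi x ->
  0 < dphi x /\ forall y, x < y <= ep -> 0 < phi y.
Proof.
move=> d1 d2 pos phi0 /andP[x0 xe] phix.
have incr u v : 0 <= u -> u < v -> v <= ep -> dphi u < dphi v.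
  move=> u0 uv ve; have [c /andP[uc cv] E] := mean_value_itv uv d2.
  rewrite -subr_gt0 E mulr_gt0 ?subr_gt0 //; apply: pos.
  by rewrite (le_trans u0 (ltW uc)) (le_trans (ltW cv) ve).
have dx : 0 < dphi x.
  have [c /andP[c0 cx] E] := mean_value_itv x0 d1.
  apply: le_lt_trans (incr c x (ltW c0) cx xe).
  by rewrite -(pmulr_lge0 _ x0) -[x in _ * x]subr0 -E subr_ge0 (le_trans phi0).
split=> // y /andP[xy ye].
have [c /andP[xc cy] E] := mean_value_itv xy d1.
apply: le_lt_trans phix _; rewrite -subr_gt0 E mulr_gt0 ?subr_gt0 //.
by apply: lt_trans dx (incr _ _ (ltW x0) xc (le_trans (ltW cy) ye)).
Qed.

Lemma norm_sign (s : R) : s * s = 1 -> `|s| = 1.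
Proof.
move=> s2; have := normrM s s; rewrite s2 normr1 -expr2 => /esym/eqP.
by rewrite sqrp_eq1 // => /eqP.
Qed.

End Convexity.

Section Step.
Variables (R : realType) (tau : R).

(** For tau = 1 or -1 this is ]0, l[ or ]-l, 0[; one parameter treats both signs of lambda. *)
Definition side (l : R) : set R := [set t | 0 < tau * t < l].

Definition vanishes (V : normedModType R) (x : R -> V) : Prop :=
  forall e, 0 < e -> exists2 d, 0 < d & forall t, side d t -> `|x t| < e.

Lemma side_le l l' : l <= l' -> side l `<=` side l'.
Proof. by move=> ll t /andP[t0 tl]; rewrite /side /= t0 (lt_le_trans tl). Qed.

Lemma open_side l : open (side l).
Proof.
have c : continuous (fun t : R => tau * t) by exact: mulrl_continuous.
have -> : side l = (fun t : R => tau * t) @^-1` [set t | 0 < t]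
                  `&` (fun t : R => tau * t) @^-1` [set t | t < l].
  by apply/seteqP; split=> t /=; rewrite /side /= => /andP.
by apply: openI; (apply: open_comp => [x _|]; first exact: c);
  [exact: open_gt | exact: open_lt].
Qed.

Variables (n : nat) (F : 'rV[R]_n -> R) (a0 : 'I_n) (sg : R).
Hypotheses (sF : smooth F) (F0 : F 0 = 0) (dF0 : partial a0 F 0 = 0).
Hypothesis (ddF0 : 0 < partial a0 (partial a0 F) 0) (sg2 : sg * sg = 1).

Let ee : 'rV[R]_n := delta_mx 0 a0.
(** The variable enters as sg * x, so that a zero of sign sg is sought among x > 0. As sg * sg = 1,
    convexity in x is unaffected. *)
Let ph (z : 'rV[R]_n) (x : R) : R := F ((sg * x) *: ee + z).
Let dph (z : 'rV[R]_n) (x : R) : R := sg * partial a0 F ((sg * x) *: ee + z).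
Let ddph (z : 'rV[R]_n) (x : R) : R :=
  partial a0 (partial a0 F) ((sg * x) *: ee + z).

Lemma is_derive_scaled_line (G : 'rV[R]_n -> R) z (x : R) : smooth G ->
  is_derive x (1 : R) (fun h : R => G ((sg * h) *: ee + z))
   (sg * partial a0 G ((sg * x) *: ee + z)).
Proof.
move=> sG.
have H1 : is_derive x (1 : R) (fun h : R => sg * h) sg.
  by apply: is_derive_eq; rewrite [LHS]mulr1.
have H2 := is_derive_line (@smooth_derivable _ _ _ a0
  ((sg * x) *: ee + z) sG).
have := @is_derive1_comp _ (fun h : R => G (h *: ee + z)) (fun h : R => sg * h)
  x _ _ H2 H1.
by rewrite [X in is_derive _ _ _ X -> _]mulrC.
Qed.

Lemma is_derive_ph z (x : R) : is_derive x (1 : R) (ph z) (dph z x).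
Proof. exact: is_derive_scaled_line. Qed.

Lemma is_derive_dph z (x : R) : is_derive x (1 : R) (dph z) (ddph z x).
Proof.
have := is_derive_scaled_line z x (@smooth_partial _ _ _ a0 sF).
move=> /(@is_deriveZ _ _ _ _ sg) H; apply: is_derive_eq H _.
by rewrite [LHS]mulrA sg2 mul1r.
Qed.


(** For small t the function [ph (gam t)] is strictly convex on [0, ep], negative somewhere close to
    0 and positive at ep. The intermediate value theorem gives a zero, convexity makes it unique and
    simple, and implicit differentiation makes it smooth in t. Negative values are required at
    arbitrarily small x rather than at 0, in order to include the transcritical case, where 0 is
    itself a zero. *)
Lemma branch_step (gam : R -> 'rV[R]_n) (l : R) : 0 < l ->
  vanishes gam -> (forall t, gam t 0 a0 = 0) ->
  (forall p a, a != a0 ->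
     times_derivable p (side l) (fun t => gam t 0 a)) ->
  (forall t, side l t -> F (gam t) <= 0 /\
     forall d, 0 < d -> exists2 x, 0 < x < d & F ((sg * x) *: ee + gam t) < 0) ->
  exists l' : R, 0 < l' <= l /\ exists x : R -> R,
  [/\ vanishes x, forall p, times_derivable p (side l') x &
      forall t, side l' t -> 0 < sg * x t /\ F (x t *: ee + gam t) = 0].
Proof.
move=> l0 gam0 gama0 gamD gamneg.
have contF : continuous F by exact: smooth_continuous.
have ball_near (z : 'rV[R]_n) (P : 'rV[R]_n -> Prop) :
    (\forall y \near z, P y) -> exists2 r, 0 < r & forall y, `|y - z| < r -> P y.
  rewrite -nbhs_nearE => /nbhs_ballP[r /= r0 rP]; exists r => // y yz; apply: rP.
  by rewrite -ball_normE /= distrC.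
have [r r0 rP] : exists2 r, 0 < r & forall y : 'rV[R]_n, `|y| < r ->
    0 < partial a0 (partial a0 F) y.
  have : \forall y \near (0 : 'rV[R]_n), 0 < partial a0 (partial a0 F) y.
    have c : {for (0 : 'rV[R]_n), continuous (partial a0 (partial a0 F))}.
      by apply: smooth_continuous; do 2 apply: smooth_partial.
    exact: (cvgr_gt _ c).
  move=> /ball_near[r r0 rP]; exists r; first exact: r0.
  by move=> y; rewrite -{1}[y]subr0; exact: rP.
(* Half of r is left for [gam t], the other half for the move along the axis. *)
pose ep := r / 2; have ep0 : 0 < ep by rewrite divr_gt0.
have nsg : `|sg| = 1 by exact: norm_sign.
have scale_le x : `|(sg * x) *: ee| <= `|x|.
  rewrite normrZ normrM nsg mul1r ler_piMr //; exact: norm_delta_mx_le.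
have conv z x : `|z| < ep -> 0 <= x <= ep -> 0 < ddph z x.
  move=> ze /andP[x0 xe]; apply: rP; rewrite (splitr r).
  apply: le_lt_trans (ler_normD _ _) _; apply: ler_ltD => //.
  by apply: le_trans (scale_le x) _; rewrite ger0_norm.
have sgn z x : `|z| < ep -> F z <= 0 -> 0 < x <= ep -> 0 <= ph z x ->
    0 < dph z x /\ forall y, x < y <= ep -> 0 < ph z y.
  move=> ze Fz; apply: (@convex_sign _ (ph z) (dph z) (ddph z)).
  - exact: is_derive_ph.
  - exact: is_derive_dph.
  - by move=> y; exact: conv.
  - by rewrite /ph mulr0 scale0r add0r.
(* At the origin F and its first derivative vanish, so the positive second derivative decides. *)
have pos0 x : 0 < x <= ep -> 0 < ph 0 x.
  move=> /andP[x0 xe]; have [c /andP[c0 cx] E] :=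
    mean_value_itv x0 (is_derive_ph 0).
  have [b /andP[b0 bc] E'] := mean_value_itv c0 (is_derive_dph 0).
  move: E E'; rewrite /ph /dph !mulr0 !scale0r !add0r F0 dF0 mulr0 !subr0 => -> ->.
  rewrite (pmulr_lgt0 _ x0) (pmulr_lgt0 _ c0).
  apply: conv; first by rewrite normr0.
  by rewrite (ltW b0) (le_trans (ltW bc)) // (le_trans (ltW cx)).
have posd x : 0 < x <= ep -> exists2 d, 0 < d & forall t, side d t ->
    0 < ph (gam t) x.
  move=> /pos0; rewrite /ph addr0 => Px.
  have /ball_near[s s0 sP] : \forall y \near (sg * x) *: ee, 0 < F y.
    exact: (cvgr_gt _ (contF _)).
  have [d d0 dP] := gam0 s s0; exists d => // t /dP gs; apply: sP.
  by rewrite addrC addKr.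
have [d1 d10 d1P] := gam0 ep ep0.
have [|d2 d20 d2P] := posd ep; first by rewrite ep0 lexx.
pose l' := Num.min l (Num.min d1 d2).
have l'P t : side l' t -> [/\ side l t, `|gam t| < ep & 0 < ph (gam t) ep].
  move=> st; split; first by apply: side_le st; rewrite ge_min lexx.
  - by apply: d1P; apply: side_le st; rewrite !ge_min lexx orbT.
  - by apply: d2P; apply: side_le st; rewrite !ge_min lexx !orbT.
have phc z : continuous (ph z).
  move=> x; apply: differentiable_continuous.
  by have [/derivable1_diffP] := is_derive_ph z x.
have /choice[z zP] t : exists z : R, side l' t -> 0 < z < ep /\ ph (gam t) z = 0.
  have [/l'P[st ge pe]|nst] := pselect (side l' t); last by exists 0.
  have [_ /(_ ep ep0)[x /andP[x0 xe] xn]] := gamneg t st.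
  have [||z] := @IVT _ (ph (gam t)) x ep 0 (ltW xe).
  - exact: continuous_subspaceT.
  - by rewrite ge_min (ltW xn) le_max (ltW pe) orbT.
  rewrite in_itv /= => /andP[xz ze] z0; exists z => _; split=> //.
  rewrite (lt_le_trans x0 xz) lt_neqAle ze andbT; apply/eqP => E.
  by move: pe; rewrite -E z0 ltxx.
have zup t y : side l' t -> z t < y <= ep -> 0 < ph (gam t) y.
  move=> st; have [/andP[z0 ze] pz] := zP t st; have [sl ge _] := l'P t st.
  have [] := sgn _ (z t) ge (gamneg t sl).1; rewrite ?z0 ?(ltW ze) ?pz //.
  by move=> _; apply.
have zdown t y : side l' t -> 0 < y < z t -> ph (gam t) y < 0.
  move=> st /andP[y0 yz]; have [/andP[z0 ze] pz] := zP t st.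
  have [sl ge _] := l'P t st; rewrite ltNge; apply/negP => py.
  have [|//|_ /(_ (z t))] := sgn _ y ge (gamneg t sl).1.
    by rewrite y0 (le_trans (ltW yz) (ltW ze)).
  by rewrite yz (ltW ze) pz ltxx => /(_ isT).
have dz t : side l' t -> 0 < dph (gam t) (z t).
  move=> st; have [/andP[z0 ze] pz] := zP t st; have [sl ge _] := l'P t st.
  by have [] := sgn _ (z t) ge (gamneg t sl).1; rewrite ?z0 ?(ltW ze) ?pz.
have gamc t : side l' t -> {for t, continuous gam}.
  move=> st; apply: continuous_curve => a.
  have [->|aa0] := eqVneq a a0.
    rewrite (_ : (fun s => _) = cst 0); first exact: derivable_cst.
    by apply/funext => s; rewrite gama0.
  by have [+ _] := gamD 1%N a aa0; move=> D; apply: D; have [] := l'P t st.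
have zc t : side l' t -> {for t, continuous z}.
  move=> st; have [/andP[z0 ze] pz] := zP t st.
  apply/(@cvgrPdist_lt _ _ _ _ (nbhs_filter t)) => e e0.
  (* The points z1 and z2 bracket [z t] inside ]0, ep[ within distance e / 2. The signs at both ends
     persist for s near t and keep [z s] in the bracket. *)
  pose z1 := Num.max (z t - e / 2) (z t / 2).
  pose z2 := Num.min (z t + e / 2) ((z t + ep) / 2).
  have e2 : 0 < e / 2 by rewrite divr_gt0.
  have z1z : 0 < z1 < z t.
    by rewrite lt_max gt_max divr_gt0 // orbT; apply/andP; split; lra.
  have z2z : z t < z2 < ep.
    by rewrite lt_min gt_min; apply/andP; split;
      [apply/andP; split; lra | apply/orP; right; lra].
  have phn y : {for t, continuous (fun s => ph (gam s) y)}.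
    apply: (@continuous_comp _ _ _ (fun s => (sg * y) *: ee + gam s) F);
      last exact: contF.
    apply: continuousD; first exact: cst_continuous.
    exact: gamc.
  have n1 : \forall s \near t, ph (gam s) z1 < 0.
    by apply: (cvgr_lt _ (phn z1)); exact: zdown.
  have n2 : \forall s \near t, 0 < ph (gam s) z2.
    apply: (cvgr_gt _ (phn z2)); apply: zup => //.
    by have /andP[-> /ltW ->] := z2z.
  have n3 : \forall s \near t, side l' s by apply: near_open => //; exact: open_side.
  near=> s.
  have ss : side l' s by near: s; exact: n3.
  have p1 : ph (gam s) z1 < 0 by near: s; exact: n1.
  have p2 : 0 < ph (gam s) z2 by near: s; exact: n2.
  have [/andP[zs0 zse] pzs] := zP s ss.
  have z1s : z1 < z s.
    rewrite ltNge; apply/negP; rewrite le_eqVlt => /orP[/eqP E|lt1].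
      by rewrite -E pzs ltxx in p1.
    have := zup s z1 ss; rewrite lt1 (le_trans (ltW (andP z1z).2)) ?(ltW ze) //.
    by move=> /(_ isT) /lt_trans/(_ p1); rewrite ltxx.
  have z2s : z s < z2.
    rewrite ltNge; apply/negP; rewrite le_eqVlt => /orP[/eqP E|lt2].
      by rewrite E pzs ltxx in p2.
    have := zdown s z2 ss; rewrite lt2 (lt_trans z0 (andP z2z).1).
    by move=> /(_ isT) /lt_trans/(_ p2); rewrite ltxx.
  move: z1s z2s; rewrite gt_max lt_min => /andP[u1 _] /andP[u2 _].
  by rewrite ltr_norml; apply/andP; split; lra.
exists l'; split.
  by rewrite !lt_min l0 d10 d20 ge_min lexx.
exists (fun t => sg * z t); split.
(* Since [ph (gam t)] is positive at dl for small t, the zero lies below dl. *)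
- move=> e e0; pose dl := Num.min (e / 2) ep.
  have dl0 : 0 < dl <= ep by rewrite lt_min ge_min lexx orbT ep0 divr_gt0.
  have [d d0 dP] := posd dl dl0.
  exists (Num.min d l'); first by rewrite !lt_min d0 l0 d10 d20.
  move=> t st; have st' : side l' t by apply: side_le st; rewrite ge_min lexx orbT.
  have [/andP[z0 ze] pz] := zP t st'.
  rewrite normrM nsg mul1r gtr0_norm //.
  have {}dP : 0 < ph (gam t) dl by apply: dP; apply: side_le st; rewrite ge_min lexx.
  have zdl : z t < dl.
    rewrite ltNge; apply/negP; rewrite le_eqVlt => /orP[/eqP E|lt2].
      by rewrite E pz ltxx in dP.
    have := zdown t dl st'; rewrite lt2 (andP dl0).1.
    by move=> /(_ isT) /lt_trans/(_ dP); rewrite ltxx.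
  apply: lt_le_trans zdl _; rewrite ge_min; apply/orP; left; lra.
- pose gx t := (sg * z t) *: ee + gam t.
  have ol : open (side l') by exact: open_side.
  move=> p; apply: (times_derivable_ext ol (g := fun s => gx s 0 a0)).
    by move=> t _; rewrite !mxE !eqxx mulr1 gama0 addr0.
  apply: (implicit_times_derivable ol sF).
  + move=> t st; have szc : sg * z s @[s --> t] --> sg * z t.
      by apply: cvgM; [exact: cvg_cst | exact: zc].
    have eec : (sg * z s) *: ee @[s --> t] --> (sg * z t) *: ee.
      by apply: cvgZ szc _; exact: cvg_cst.
    exact: (cvgD eec (gamc t st)).
  + by move=> t st; have [_] := zP t st.
  + move=> t /dz; rewrite /dph => /lt0r_neq0.
    by rewrite mulf_eq0 negb_or => /andP[_].
  + move=> {}p a aa0; apply: (times_derivable_ext ol (g := fun s => gam s 0 a)).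
      by move=> t _; rewrite [RHS]mxE mxE mxE (negbTE aa0) andbF mulr0 add0r.
    apply: times_derivable_sub (gamD p a aa0).
    by apply: side_le; rewrite ge_min lexx.
- move=> t st; have [/andP[z0 ze] pz] := zP t st.
  by rewrite mulrA sg2 mul1r.
Unshelve. all: by end_near. Qed.

End Step.

(** * The equations of the layers *)

Section SmoothCombination.
Variables (R : realType) (n : nat).
Implicit Types f g : 'rV[R]_n -> R.

Lemma partial_comb f g (c : R) a :
  (forall x, derivable f x (delta_mx 0 a)) ->
  (forall x, derivable g x (delta_mx 0 a)) ->
  partial a (fun x => f x + c * g x) = fun x => partial a f x + c * partial a g x.
Proof.
move=> df dg; apply/funext => x; rewrite /partial.
have := @deriveD _ _ _ f (c *: g) x (delta_mx 0 a) (df x)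
  (@derivableZ _ _ _ g c x _ (dg x)).
by rewrite deriveZ.
Qed.

Lemma iter_partial_comb f g (c : R) s : smooth f -> smooth g ->
  iter_partial s (fun x => f x + c * g x) =
  fun x => iter_partial s f x + c * iter_partial s g x.
Proof.
move=> sf sg; elim: s => //= a s ->.
by rewrite partial_comb // => x; [exact: (sf s).2 | exact: (sg s).2].
Qed.

Lemma smooth_comb f g (c : R) : smooth f -> smooth g ->
  smooth (fun x => f x + c * g x).
Proof.
move=> sf sg s; rewrite iter_partial_comb //; split=> [x|a x].
  have [cf _] := sf s; have [cg _] := sg s.
  exact: (cvgD (cf x) (cvgM (cvg_cst c) (cg x))).
apply: (@derivableD _ _ _ (iter_partial s f) (c *: iter_partial s g)).
  exact: (sf s).2.
by apply: derivableZ; exact: (sg s).2.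
Qed.

Lemma smoothN f : smooth f -> smooth (fun x => - f x).
Proof.
move=> sf; rewrite (_ : (fun x => - f x) = fun x => f x + (-2) * f x).
  exact: smooth_comb.
by apply/funext => x; ring.
Qed.

Lemma partialN f a : smooth f ->
  partial a (fun x => - f x) = fun x => - partial a f x.
Proof.
move=> sf; apply/funext => x; apply: deriveN.
exact: smooth_derivable.
Qed.

End SmoothCombination.

Section Points.
Variables (R : realType) (k : nat).
Implicit Types (w : 'I_k -> R) (x lam : R).

Definition var_source (i : 'I_k) : 'I_(1 + k + 1) := lshift 1 (rshift 1 i).
Definition var_lam : 'I_(1 + k + 1) := rshift (1 + k) ord0.

Lemma varP (a : 'I_(1 + k + 1)) :
  [\/ a = var0 k, exists i, a = var_source i | a = var_lam].
Proof.
case: (split_ordP a) => [b ->|b ->]; last by rewrite ord1; apply: Or33.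
case: (split_ordP b) => [c ->|c ->]; first by rewrite ord1; apply: Or31.
by apply: Or32; exists c.
Qed.

Lemma var_source_inj : injective var_source.
Proof. by move=> i j /lshift_inj/rshift_inj. Qed.

Lemma point_var0 x w lam : point x w lam 0 (var0 k) = x.
Proof. by rewrite /point /var0 ?/var_source ?/var_lam row_mxEl row_mxEl mxE. Qed.

Lemma point_source x w lam i : point x w lam 0 (var_source i) = w i.
Proof. by rewrite /point /var0 ?/var_source ?/var_lam row_mxEl row_mxEr mxE. Qed.

Lemma point_lam x w lam : point x w lam 0 var_lam = lam.
Proof. by rewrite /point /var0 ?/var_source ?/var_lam row_mxEr mxE. Qed.

Lemma var_source_neq0 i : var_source i != var0 k.
Proof. by apply/eqP => /lshift_inj /eqP; rewrite -val_eqE. Qed.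

Lemma var_lam_neq0 : var_lam != var0 k.
Proof. by rewrite -val_eqE. Qed.

Lemma var_lam_source i : var_lam != var_source i.
Proof. by rewrite eq_sym /var_lam /var_source eq_lrshift. Qed.

Definition pointE := (point_var0, point_source, point_lam).

Lemma pointP (u v : 'rV[R]_(1 + k + 1)) : u 0 (var0 k) = v 0 (var0 k) ->
  (forall i, u 0 (var_source i) = v 0 (var_source i)) ->
  u 0 var_lam = v 0 var_lam -> u = v.
Proof.
move=> h0 hi hl; apply/rowP => a.
by have [->|[i ->]|->] := varP a.
Qed.

Lemma point_shift x w lam :
  point x w lam = x *: delta_mx 0 (var0 k) + point 0 w lam.
Proof.
apply: pointP => [|i|]; rewrite [RHS]mxE !pointE !mxE ?eqxx ?mulr1 ?addr0 //.
  by rewrite (negbTE (var_source_neq0 i)) mulr0 add0r.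
by rewrite (negbTE var_lam_neq0) mulr0 add0r.
Qed.

Lemma point_lam_line lam :
  point 0 (fun=> 0) lam = lam *: delta_mx 0 var_lam :> 'rV[R]_(1 + k + 1).
Proof.
apply: pointP => [|i|]; rewrite pointE !mxE ?eqxx ?mulr1 //.
  by rewrite eq_sym (negbTE var_lam_neq0) mulr0.
by rewrite andTb eq_sym (negbTE (var_lam_source i)) mulr0.
Qed.

Lemma point0 : point 0 (fun=> 0) 0 = 0 :> 'rV[R]_(1 + k + 1).
Proof. by rewrite point_lam_line scale0r. Qed.

Lemma norm_point_lt x w lam (e : R) : 0 < e -> `|x| < e ->
  (forall i, `|w i| < e) -> `|lam| < e -> `|point x w lam| < e.
Proof.
move=> e0 xe we le; rewrite -[ltLHS]/(mx_norm _) mx_normrE.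
apply: bigmax_lt => // -[i a] _ /=; rewrite ord1.
by have [->|[j ->]|->] := varP a; rewrite pointE.
Qed.

End Points.

Section LayerEquations.
Variables (R : realType) (k : nat) (f : 'rV[R]_(1 + k + 1) -> R).
Hypotheses (sf : smooth f) (f0 : forall lam, f (point 0 (fun=> 0) lam) = 0).
Hypothesis df0 : partial (var0 k) f 0 = 0.
Hypothesis ddf0 : 0 < partial (var0 k) (partial (var0 k) f) 0.

(** What the single cell of layer j + 1 sees when one of its sources has the value y and the others
    vanish. With all types in [J] it is what the cells of higher layers see. *)
Definition inputs (J : {set 'I_k}) (y : R) : 'I_k -> R :=
  fun i => if i \in J then y else 0.

(** The derivative of g along the indicator vector of [J], that is, with respect to the input value
    y. *)
Definition slope (g : 'rV[R]_(1 + k + 1) -> R) (J : {set 'I_k})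
    (z : 'rV[R]_(1 + k + 1)) : R :=
  \sum_(i in J) partial (var_source i) g z.

Lemma inputs0 J : inputs J 0 = fun=> 0.
Proof. by apply/funext => i; rewrite /inputs if_same. Qed.

Lemma norm_inputs_lt J y (e : R) i : 0 < e -> `|y| < e -> `|inputs J y i| < e.
Proof. by rewrite /inputs; case: ifP => // _ e0 _; rewrite normr0. Qed.

Lemma near0_lt (V : normedModType R) (g : V -> R) (c : R) :
  {for 0, continuous g} -> g 0 < c ->
  exists2 r, 0 < r & forall y, `|y| < r -> g y < c.
Proof.
move=> cg gc; have : \forall y \near (0 : V), g y < c by exact: (cvgr_lt _ cg).
rewrite -nbhs_nearE => /nbhs_ballP[r /= r0 rP]; exists r; first exact: r0.
by move=> y yz; apply: rP; rewrite -ball_normE /= sub0r normrN.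
Qed.

Lemma continuousMl (V : normedModType R) (g : V -> R) (c : R) x :
  {for x, continuous g} -> {for x, continuous (fun y => c * g y)}.
Proof. by move=> cg; exact: (cvgM (cvg_cst c) cg). Qed.

Lemma is_derive_inputs J t (h : R) :
  is_derive h (1 : R) (fun h => f (point 0 (inputs J h) t))
    (slope f J (point 0 (inputs J h) t)).
Proof.
pose gam (h : R) := point 0 (inputs J h) t : 'rV[R]_(1 + k + 1).
have E0 : (fun s => gam s 0 (var0 k)) = cst 0.
  by apply/funext => s; rewrite /gam pointE.
have El : (fun s => gam s 0 (var_lam k)) = cst t.
  by apply/funext => s; rewrite /gam pointE.
have Ei i : (fun s => gam s 0 (var_source i)) = if i \in J then id else cst 0.
  by apply/funext => s; rewrite /gam pointE /inputs; case: ifP.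
have dg a : derivable (fun s => gam s 0 a) h 1.
  have [->|[i ->]|->] := varP a; rewrite ?E0 ?El ?Ei.
  - exact: derivable_cst.
  - by case: ifP => _; [exact: derivable_id | exact: derivable_cst].
  - exact: derivable_cst.
have := chain_rule sf dg; rewrite /comp.
rewrite big_split_ord /= big_split_ord /= !big_ord1.
rewrite -/(var0 k) -/(var_lam k) E0 El !derive1_cst !mulr0 add0r addr0.
rewrite (_ : \sum_(i < k) _ = slope f J (gam h)) // /slope [RHS]big_mkcond.
apply: eq_bigr => i _; rewrite -/(var_source i) Ei.
by case: ifP => _; rewrite ?derive1_id ?derive1_cst ?mulr1 ?mulr0.
Qed.

Section Sides.
Variable tau : R.
Hypothesis tau2 : tau * tau = 1.

Lemma side_norm l t : side tau l t -> `|t| = tau * t.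
Proof.
by move=> /andP[t0 _]; rewrite -(gtr0_norm t0) normrM (norm_sign tau2) mul1r.
Qed.

Lemma side_norm_lt l t : side tau l t -> `|t| < l.
Proof. by move=> st; rewrite (side_norm st); have /andP[] := st. Qed.

Lemma vanishes_point J y : vanishes tau y ->
  vanishes tau (fun t => point 0 (inputs J (y t)) t : 'rV[R]_(1 + k + 1)).
Proof.
move=> vy e e0; have [d d0 dP] := vy e e0.
exists (Num.min d e); first by rewrite lt_min d0 e0.
move=> t st; apply: norm_point_lt => //; first by rewrite normr0.
  move=> i; apply: norm_inputs_lt => //; apply: dP.
  by apply: side_le st; rewrite ge_min lexx.
by apply: side_norm_lt; apply: side_le st; rewrite ge_min lexx orbT.
Qed.

Lemma times_derivable_point J y l :
  (forall p, times_derivable p (side tau l) y) ->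
  forall p a, a != var0 k -> times_derivable p (side tau l)
    (fun t => (point 0 (inputs J (y t)) t : 'rV[R]_(1 + k + 1)) 0 a).
Proof.
move=> dy p a; have ol : open (side tau l) by exact: open_side.
have [->|[i ->]|->] := varP a; rewrite ?eqxx // => _.
- rewrite (_ : (fun t => _) = if i \in J then y else cst 0).
    by case: ifP => _ //; exact: times_derivable_cst.
  by apply/funext => t; rewrite pointE /inputs; case: ifP.
- rewrite (_ : (fun t => _) = id); first exact: times_derivable_id.
  by apply/funext => t; rewrite pointE.
Qed.

(** As f vanishes for zero input, its value is y t times a slope close to [slope f J 0], and that
    slope has the sign opposite to y t. *)
Lemma input_negative J (y : R -> R) l sg : 0 < l -> sg * sg = 1 ->
  vanishes tau y -> (forall t, side tau l t -> 0 < sg * y t) ->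
  sg * slope f J 0 < 0 ->
  exists2 l', 0 < l' <= l &
    forall t, side tau l' t -> f (point 0 (inputs J (y t)) t) < 0.
Proof.
move=> l0 sg2 vy sy sS.
have cS : {for (0 : 'rV[R]_(1 + k + 1)), continuous (slope f J)}.
  apply: (cvg_big (@add_continuous R) (nbhs_filter _)) => i _.
  by apply: smooth_continuous; exact: smooth_partial.
have [r r0 rP] := near0_lt (continuousMl (c := sg) cS) sS.
have [d d0 dP] := vy r r0.
exists (Num.min l (Num.min d r)); first by rewrite !lt_min l0 d0 r0 ge_min lexx.
move=> t st.
have tl : side tau l t by apply: side_le st; rewrite ge_min lexx.
have yr : `|y t| < r by apply: dP; apply: side_le st; rewrite !ge_min lexx orbT.
have tr : `|t| < r.
  by apply: side_norm_lt; apply: side_le st; rewrite !ge_min lexx !orbT.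
have [c cy E] := mean_value 0 (y t) (is_derive_inputs J t).
rewrite inputs0 f0 !subr0 in cy E; rewrite E.
have neg : sg * slope f J (point 0 (inputs J c) t) < 0.
  apply: rP; apply: norm_point_lt => //; first by rewrite normr0.
  by move=> i; apply: norm_inputs_lt => //; exact: le_lt_trans yr.
rewrite -[X in X < _]mul1r -sg2 mulrACA.
by rewrite nmulr_rlt0 //; exact: sy.
Qed.

Lemma continuous_scaled_line (g : 'rV[R]_(1 + k + 1) -> R) z sg : smooth g ->
  continuous (fun x : R => g ((sg * x) *: delta_mx 0 (var0 k) + z)).
Proof.
move=> smg x; apply: differentiable_continuous.
by have [/derivable1_diffP] := is_derive_scaled_line (var0 k) sg z x smg.
Qed.

(** Here f is negative at x = 0 and therefore also at small x of either sign, which leaves the sign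
    sg' of the solution free. The sign sg of the input is not free. *)
Lemma layer_solution J (y : R -> R) l sg sg' : 0 < l ->
  sg * sg = 1 -> sg' * sg' = 1 ->
  vanishes tau y -> (forall p, times_derivable p (side tau l) y) ->
  (forall t, side tau l t -> 0 < sg * y t) -> sg * slope f J 0 < 0 ->
  exists l' : R, 0 < l' <= l /\ exists x : R -> R,
  [/\ vanishes tau x, forall p, times_derivable p (side tau l') x &
      forall t, side tau l' t ->
        0 < sg' * x t /\ f (point (x t) (inputs J (y t)) t) = 0].
Proof.
move=> l0 sg2 sg'2 vy dy sy sS.
have [l1 /andP[l10 l1l] neg] := input_negative l0 sg2 vy sy sS.
have F0 : f 0 = 0 by rewrite -point0 f0.
have dy1 p : times_derivable p (side tau l1) y.
  by apply: times_derivable_sub (dy p); exact: side_le.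
pose gam t : 'rV[R]_(1 + k + 1) := point 0 (inputs J (y t)) t.
have gama0 t : gam t 0 (var0 k) = 0 by rewrite /gam pointE.
have gamneg t : side tau l1 t -> f (gam t) <= 0 /\ forall d, 0 < d ->
    exists2 x, 0 < x < d & f ((sg' * x) *: delta_mx 0 (var0 k) + gam t) < 0.
  move=> st; split; first exact: ltW (neg t st).
  move=> d d0; have c := continuous_scaled_line (z := gam t) (sg := sg') sf (x := 0).
  have [r r0 rP] : exists2 r, 0 < r & forall x : R, `|x| < r ->
      f ((sg' * x) *: delta_mx 0 (var0 k) + gam t) < 0.
    by apply: near0_lt c _; rewrite mulr0 scale0r add0r; exact: neg.
  have m0 : 0 < Num.min d r by rewrite lt_min d0 r0.
  have md : Num.min d r <= d by rewrite ge_min lexx.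
  have mr : Num.min d r <= r by rewrite ge_min lexx orbT.
  exists (Num.min d r / 2); first by apply/andP; split; lra.
  by apply: rP; rewrite gtr0_norm; lra.
have [l' [/andP[l'0 l'l1] [x [vx dx xP]]]] := branch_step sf F0 df0 ddf0 sg'2
  l10 (vanishes_point J vy) gama0 (times_derivable_point J dy1) gamneg.
exists l'; rewrite l'0 (le_trans l'l1) //; split=> //.
by exists x; split=> // t st; rewrite point_shift; exact: xP.
Qed.

(** In the direction sg the function f(x, 0, lambda) leaves its zero at x = 0 with a negative slope
    of size at least A |lambda|, so [branch_step] applies. The bound kap comes from the time this
    slope needs to be compensated. *)
Lemma transcritical_solution sg : sg * sg = 1 ->
  sg * tau * partial (var_lam k) (partial (var0 k) f) 0 < 0 ->
  exists2 l : R, 0 < l & exists (s : R -> R) (kap : R),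
  [/\ vanishes tau s, forall p, times_derivable p (side tau l) s,
      0 < kap, forall t, side tau l t -> kap * `|t| <= `|s t| &
      forall t, side tau l t -> 0 < sg * s t /\ f (point (s t) (fun=> 0) t) = 0].
Proof.
move=> sg2 sneg.
have sd0 : smooth (partial (var0 k) f) by exact: smooth_partial.
set dl := partial (var_lam k) (partial (var0 k) f) in sneg.
pose dd := partial (var0 k) (partial (var0 k) f).
have dd0 : 0 < dd 0 by exact: ddf0.
(* Half of |f_0lambda|; the other half leaves room for continuity near the origin. *)
pose A := - (sg * tau * dl 0) / 2.
have A0 : 0 < A by rewrite /A; lra.
have cdl : {for (0 : 'rV[R]_(1 + k + 1)), continuous dl}.
  by apply: smooth_continuous; exact: smooth_partial.
have cdd : {for (0 : 'rV[R]_(1 + k + 1)), continuous dd}.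
  by apply: smooth_continuous; exact: smooth_partial.
have [|r r0 rP] := near0_lt (c := - A) (continuousMl (c := sg * tau) cdl).
  by rewrite /A; lra.
have [|r' r'0 r'P] := near0_lt (c := dd 0 + 1) cdd; first by lra.
have qneg t : side tau r t ->
    sg * partial (var0 k) f (point 0 (fun=> 0) t) < - A * `|t|.
  move=> st; have tr := side_norm_lt st.
  have [c ct E] := mean_value 0 t (fun u =>
    is_derive_line (@smooth_derivable _ _ _ (var_lam k)
       (u *: delta_mx 0 (var_lam k) + 0) sd0)).
  rewrite !addr0 scale0r !subr0 df0 subr0 -point_lam_line in ct E.
  rewrite E (side_norm st) -[X in X < _]mul1r -tau2.
  rewrite (_ : _ * _ = sg * tau * dl (c *: delta_mx 0 (var_lam k)) * (tau * t));
    last by rewrite /dl /partial; ring.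
  rewrite ltr_pM2r; last by have /andP[] := st.
  apply: rP; rewrite -point_lam_line; apply: norm_point_lt => //.
  - by rewrite normr0.
  - by move=> i; rewrite normr0.
  - exact: le_lt_trans tr.
have F0 : f 0 = 0 by rewrite -point0 f0.
have v0 : vanishes tau (fun=> 0 : R).
  by move=> e e0; exists 1 => // t _; rewrite normr0.
have td0 p : times_derivable p (side tau r) (fun=> 0).
  by apply: times_derivable_cst; exact: open_side.
(* Zero input is written as an instance of [inputs] so that the lemmas on curves of this form
   apply. *)
pose z t : 'rV[R]_(1 + k + 1) := point 0 (inputs finset.set0 0) t.
have zE t : z t = point 0 (fun=> 0) t by rewrite /z inputs0.
have z0 t : z t 0 (var0 k) = 0 by rewrite /z pointE.
have zneg t : side tau r t -> f (z t) <= 0 /\ forall d, 0 < d ->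
    exists2 x, 0 < x < d & f ((sg * x) *: delta_mx 0 (var0 k) + z t) < 0.
  move=> st; rewrite zE f0; split=> // d d0.
  have c := continuous_scaled_line (z := point 0 (fun=> 0) t) (sg := sg) sd0 (x := 0).
  have [e e0 eP] : exists2 e, 0 < e & forall x : R, `|x| < e ->
     sg * partial (var0 k) f ((sg * x) *: delta_mx 0 (var0 k) + point 0 (fun=> 0) t) < 0.
    apply: near0_lt (continuousMl (c := sg) c) _.
    rewrite mulr0 scale0r add0r; apply: lt_le_trans (qneg t st) _.
    by rewrite mulNr oppr_le0 mulr_ge0 // ltW.
  have m0 : 0 < Num.min d e by rewrite lt_min d0 e0.
  have md : Num.min d e <= d by rewrite ge_min lexx.
  have me : Num.min d e <= e by rewrite ge_min lexx orbT.
  exists (Num.min d e / 2); first by apply/andP; split; lra.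
  have x0 : 0 < Num.min d e / 2 by lra.
  have [b /andP[b0 bx]] := mean_value_itv x0
    (fun u => is_derive_scaled_line (var0 k) sg (point 0 (fun=> 0) t) u sf).
  rewrite mulr0 scale0r add0r f0 !subr0 => ->; rewrite pmulr_llt0 //; apply: eP.
  by rewrite gtr0_norm //; lra.
have [l [/andP[l0 lr] [s [vs ds sP]]]] := branch_step sf F0 df0 ddf0 sg2 r0
  (vanishes_point finset.set0 v0) z0 (times_derivable_point finset.set0 td0) zneg.
have K0 : 0 < dd 0 + 1 by lra.
have [d1 d10 d1P] := vs r' r'0.
have sub t : side tau (Num.min l (Num.min d1 r')) t ->
   [/\ side tau l t, side tau d1 t & side tau r' t].
  by move=> st; split; apply: side_le st; rewrite !ge_min lexx ?orbT.
exists (Num.min l (Num.min d1 r')); first by rewrite !lt_min l0 d10 r'0.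
exists s, (A / (dd 0 + 1)); split=> //.
- move=> p; apply: times_derivable_sub (ds p) => t /sub; by case.
- exact: divr_gt0.
- move=> t /sub[st sd1 sr']; have [sx fx] := sP t st.
  rewrite -/(z t) zE in fx.
  (* Rolle's theorem between the zeros 0 and [s t] gives a zero b of f_0, in the scaled variable. *)
  have [b /andP[b0 bx]] := mean_value_itv sx
    (fun u => is_derive_scaled_line (var0 k) sg (point 0 (fun=> 0) t) u sf).
  rewrite mulrA sg2 mul1r mulr0 scale0r add0r fx f0 !subr0 => /esym/eqP.
  rewrite mulf_eq0 (gt_eqF sx) orbF => /eqP E1.
  (* Over the length b the quantity sg * f_0 climbs from below - A |t| to 0 at a rate below dd 0 +
     1. Hence b, and with it |s t|, exceeds A |t| / (dd 0 + 1). *)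
  have [c /andP[c0 cb]] := mean_value_itv b0
    (fun u => is_derive_scaled_line (var0 k) sg (point 0 (fun=> 0) t) u sd0).
  rewrite mulr0 scale0r add0r subr0.
  set ddc := partial (var0 k) (partial (var0 k) f) _ => E2.
  have ssx : `|s t| = sg * s t.
    by rewrite -[RHS]gtr0_norm // normrM (norm_sign sg2) mul1r.
  have ddcK : ddc < dd 0 + 1.
    apply: r'P; rewrite -point_shift; apply: norm_point_lt => //.
    - rewrite normrM (norm_sign sg2) mul1r gtr0_norm //.
      by apply: lt_trans cb (lt_trans bx _); rewrite -ssx; exact: d1P.
    - by move=> i; rewrite normr0.
    - exact: side_norm_lt sr'.
  have q := qneg t (side_le lr st).
  have E3 : sg * partial (var0 k) f (point 0 (fun=> 0) t) = - (ddc * b).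
    have := congr1 (fun u => sg * u) E2; rewrite /= mulrBr E1 sub0r !mulrA sg2.
    by rewrite mul1r => <-; rewrite opprK.
  rewrite E3 mulNr ltrN2 in q.
  rewrite mulrAC ler_pdivrMr // ssx; apply: ltW; apply: lt_trans q _.
  rewrite mulrC; apply: lt_trans (_ : b * (dd 0 + 1) < _).
    by rewrite ltr_pM2l.
  by rewrite ltr_pM2r.
- by move=> t /sub[st _ _]; have := sP t st; rewrite -/(z t) zE -point_shift.
Qed.

End Sides.
End LayerEquations.

(** * Compatible signs and solutions of consecutive layers *)

Section Chains.
Variables (R : realType) (k : nat).
Implicit Types (f : 'rV[R]_(1 + k + 1) -> R) (J : {set 'I_k}).

Definition half_germ (tau l : R) (y : R -> R) : Prop :=
  vanishes tau y /\ forall p, times_derivable p (side tau l) y.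

Lemma half_germ_le tau l l' y :
  l' <= l -> half_germ tau l y -> half_germ tau l' y.
Proof.
move=> ll [vy dy]; split=> // p; apply: times_derivable_sub (dy p).
exact: side_le.
Qed.

Lemma half_germ_cst0 tau l : half_germ tau l (fun=> 0).
Proof.
split=> [e e0|p]; first by exists 1 => // t _; rewrite normr0.
by apply: times_derivable_cst; exact: open_side.
Qed.

(* [s] lives in the first nonzero layer, [y r] is the common value of the cells
   [r + 1] layers above it. *)
Definition layer_chain f J (tau l kap : R) (M : nat) (s : R -> R)
    (y : nat -> R -> R) : Prop :=
  [/\ half_germ tau l s, forall r, (r <= M)%N -> half_germ tau l (y r) &
    forall t, side tau l t ->
    [/\ kap * `|t| <= `|s t|, f (point (s t) (fun=> 0) t) = 0,
        f (point (y 0%N t) (inputs J (s t)) t) = 0 &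
        forall r, (r < M)%N -> f (point (y r.+1 t) (fun=> y r t) t) = 0]].

Lemma inputs_setT (y : R) : inputs [set: 'I_k] y = fun=> y.
Proof. by apply/funext => i; rewrite /inputs inE. Qed.

Lemma sgr_sqr (x : R) : x != 0 -> Num.sg x * Num.sg x = 1.
Proof. by move=> x0; rewrite -expr2 sqr_sg x0. Qed.

Lemma exists_sign (x : R) : x != 0 -> exists2 sg : R, sg * sg = 1 & sg * x < 0.
Proof.
move=> x0; exists (- Num.sg x); first by rewrite mulrNN sgr_sqr.
by rewrite mulNr -normrEsg oppr_lt0 normr_gt0.
Qed.

(** The signs sg of s and sg' of all y r are read off from the two slopes, and tau from sg and
    f_0lambda. Only the length l shrinks with each added layer, so tau can be chosen before M. *)
Lemma pos_layer_chain f J : smooth f ->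
  (forall lam, f (point 0 (fun=> 0) lam) = 0) -> partial (var0 k) f 0 = 0 ->
  0 < partial (var0 k) (partial (var0 k) f) 0 ->
  partial (var_lam k) (partial (var0 k) f) 0 != 0 ->
  slope f J 0 != 0 -> slope f [set: 'I_k] 0 != 0 ->
  exists2 tau : R, tau * tau = 1 & forall M, exists l kap s y,
    [/\ 0 < l, 0 < kap & layer_chain f J tau l kap M s y].
Proof.
move=> sf f0 df0 ddf0 dl SJ ST.
have [sg sg2 sgJ] := exists_sign SJ; have [sg' sg'2 sgT] := exists_sign ST.
have [tau tau2 taul] : exists2 tau : R, tau * tau = 1 &
    sg * tau * partial (var_lam k) (partial (var0 k) f) 0 < 0.
  have [t t2 tl] := exists_sign dl; exists (sg * t).
    by rewrite mulrACA sg2 t2 mulr1.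
  by rewrite mulrA sg2 mul1r.
exists tau => // M.
(* The induction also carries the sign of the topmost solution, which is the input of the next
   layer. *)
suff [l [kap [s [y [l0 kap0 ch _]]]]] : exists l kap s y,
    [/\ 0 < l, 0 < kap, layer_chain f J tau l kap M s y &
        forall t, side tau l t -> 0 < sg' * y M t].
  by exists l, kap, s, y.
have [l0 l00 [s [kap [vs ds kap0 sk sP]]]] :=
  transcritical_solution sf f0 df0 ddf0 tau2 sg2 taul.
elim: M => [|M [l [{sk vs ds sP}kap' [s' [y [l_0 kap'0 [gs gy ch] ypos]]]]]].
  have [l [/andP[l_0 ll] [x [vx dx xP]]]] := layer_solution sf f0 df0 ddf0 tau2 l00
    sg2 sg'2 vs ds (fun t st => (sP t st).1) sgJ.
  exists l, kap, s, (fun=> x); split=> //; last by move=> t /xP[].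
  split=> [|//|t st]; first exact: (half_germ_le ll (conj vs ds)).
  have st0 := side_le ll st.
  by split=> //; [exact: sk | have [] := sP t st0 | have [] := xP t st].
have [vy dy] := gy M (leqnn M).
have [l' [/andP[l'_0 ll] [x [vx dx xP]]]] := layer_solution sf f0 df0 ddf0 tau2 l_0
    sg'2 sg'2 vy dy ypos sgT.
exists l', kap', s', (fun r => if (r <= M)%N then y r else x); split=> //; last first.
  by move=> t st; rewrite ltnn; have [] := xP t st.
split=> [|r _|t st]; first exact: half_germ_le ll gs.
  by case: ifP => // rM; exact: half_germ_le ll (gy r rM).
have st0 := side_le ll st; have [c1 c2 c3 c4] := ch t st0.
split=> // r; rewrite ltnS => rM; rewrite rM.
case: ltnP => [/c4 //|Mr].
have -> : r = M by apply/eqP; rewrite eqn_leq rM.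
by have [_] := xP t st; rewrite inputs_setT.
Qed.

(** When f_00 < 0 one passes to - f, which has the same zeros and the same nonvanishing
    conditions. *)
Lemma exists_layer_chain f J : smooth f ->
  (forall lam, f (point 0 (fun=> 0) lam) = 0) -> partial (var0 k) f 0 = 0 ->
  partial (var0 k) (partial (var0 k) f) 0 != 0 ->
  partial (var_lam k) (partial (var0 k) f) 0 != 0 ->
  slope f J 0 != 0 -> slope f [set: 'I_k] 0 != 0 ->
  exists2 tau : R, tau * tau = 1 & forall M, exists l kap s y,
    [/\ 0 < l, 0 < kap & layer_chain f J tau l kap M s y].
Proof.
move=> sf f0 df0 ddf0 dl SJ ST; move: (ddf0); rewrite neq_lt => /orP[neg|]; last first.
  by move=> pos; exact: pos_layer_chain.
have slopeN K : slope (fun x => - f x) K 0 = - slope f K 0.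
  by rewrite /slope -sumrN; apply: eq_bigr => i _; rewrite partialN.
have s0 : smooth (partial (var0 k) f) by exact: smooth_partial.
have [| | | | | | |tau tau2 H] := @pos_layer_chain (fun x => - f x) J.
- exact: smoothN.
- by move=> lam; rewrite f0 oppr0.
- by rewrite partialN // df0 oppr0.
- by rewrite partialN // partialN // oppr_gt0.
- by rewrite partialN // partialN // oppr_eq0.
- by rewrite slopeN oppr_eq0.
- by rewrite slopeN oppr_eq0.
exists tau => // M; have [l [kap [s [y [l0 kap0 [gs gy ch]]]]]] := H M.
exists l, kap, s, y; split=> //; split=> // t /ch[c1 c2 c3 c4].
have oppr0E (x : R) : - x = 0 -> x = 0.
  by move=> /eqP; rewrite oppr_eq0 => /eqP.
split=> //; [exact: oppr0E c2 | exact: oppr0E c3 |].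
by move=> r /c4 c; exact: oppr0E c.
Qed.

End Chains.

(** * One-sided domains *)

Section HalfLines.
Variables (R : realType) (tau : R).
Hypothesis tau2 : tau * tau = 1.

Definition half_domain (l : R) : set R := [set t | 0 <= tau * t < l].

Lemma tau_neq0 : tau != 0.
Proof.
apply/eqP => E; move: tau2; rewrite E mul0r => /eqP.
by rewrite eq_sym oner_eq0.
Qed.

Lemma half_domainP l t : half_domain l t -> t != 0 -> side tau l t.
Proof.
move=> /andP[t0 tl] tn0; rewrite /side /= tl andbT lt_neqAle t0 andbT eq_sym.
by rewrite mulf_neq0 // tau_neq0.
Qed.

Lemma side_half_domain l t : side tau l t -> half_domain l t.
Proof. by move=> /andP[t0 tl]; rewrite /half_domain /= tl ltW. Qed.

Lemma half_domain_setD l : half_domain l `\ 0 = side tau l.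
Proof.
apply/seteqP; split=> t; first by move=> [dt /eqP t0]; exact: half_domainP.
move=> st; split; first exact: side_half_domain.
by move=> /= t0; move: st; rewrite t0 /side /= mulr0 ltxx.
Qed.

Lemma half_domainE l :
  half_domain l = `]- l, 0]%classic \/ half_domain l = `[0, l[%classic.
Proof.
have : (tau - 1) * (tau + 1) = 0 by rewrite -subr_sqr_1 expr2 tau2 subrr.
move=> /eqP; rewrite mulf_eq0 subr_eq0 addr_eq0 => /orP[]/eqP tauE.
  by right; apply/seteqP; split=> t; rewrite /half_domain /= tauE mul1r in_itv.
left; apply/seteqP; split=> t; rewrite /half_domain /= tauE mulN1r in_itv /=;
  by rewrite oppr_ge0 andbC ltrNl.
Qed.

(** A [half_germ] is constrained only off 0, while a branch must take the value 0 there. *)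
Definition zero_at0 (y : R -> R) : R -> R := fun t => if t == 0 then 0 else y t.

Lemma half_germ_regular l y : half_germ tau l y ->
  {within half_domain l, continuous (zero_at0 y)} /\
  smooth_on (half_domain l `\ 0) (zero_at0 y).
Proof.
move=> [vy dy]; have ol : open (side tau l) by exact: open_side.
have dz p : times_derivable p (side tau l) (zero_at0 y).
  apply: times_derivable_ext (dy p) => // t /andP[t0 _]; rewrite /zero_at0.
  by case: eqVneq => // tE; rewrite tE mulr0 ltxx in t0.
split; last by rewrite half_domain_setD; apply/smooth_onP.
apply/subspace_continuousP => t Dt; have [->|tn0] := eqVneq t 0; last first.
  have [/(_ t (half_domainP Dt tn0)) /derivable1_diffP d _] := dz 1%N.
  by apply: cvg_within_filter; exact: differentiable_continuous d.
have z0 : zero_at0 y 0 = 0 by rewrite /zero_at0 eqxx.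
rewrite /from_subspace z0.
apply/cvgr0Pnorm_lt => e e0.
have [d d0 dP] := vy e e0.
rewrite near_withinE; apply/nbhs_ballP; exists (Num.min d l).
  rewrite /= lt_min d0; move: Dt => /andP[]; exact: le_lt_trans.
move=> x; rewrite -ball_normE /= sub0r normrN => xd Dx.
rewrite /zero_at0; case: eqVneq => [_|xn0]; first by rewrite normr0.
have := half_domainP Dx xn0 => /andP[x0 xl]; apply: dP.
rewrite /side /= x0 /=; apply: le_lt_trans (lt_le_trans xd _).
  by rewrite -(side_norm tau2 (l := l)) ?lexx // /side /= x0.
by rewrite ge_min lexx.
Qed.

End HalfLines.

(** * Genericity *)

Section Quadratic.
Variables (R : realType) (n : nat).
Implicit Types f : 'rV[R]_n -> R.

Lemma smooth_of_partials f : continuous f ->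
  (forall a x, derivable f x (delta_mx 0 a)) ->
  (forall a, smooth (partial a f)) -> smooth f.
Proof.
move=> cf df sf s; elim/last_ind: s => [//|s a _].
by have := sf a s; rewrite /iter_partial foldr_rcons.
Qed.

Lemma partial_cst (c : R) (a : 'I_n) : partial a (cst c) = cst 0.
Proof. by apply/funext => x; exact: derive_cst. Qed.

Lemma smooth_cst (c : R) : smooth (cst c : 'rV[R]_n -> R).
Proof.
move=> s; have [c' ->] : exists c', iter_partial s (cst c) = cst c'.
  elim: s => [|a s [c' /= ->]]; first by exists c.
  by exists 0; exact: partial_cst.
split=> [x|a x]; first exact: cst_continuous.
exact: derivable_cst.
Qed.

Lemma derivable_coord (b : 'I_n) (x v : 'rV[R]_n) :
  derivable (fun z : 'rV[R]_n => z 0 b) x v.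
Proof.
have /derivable_mxP H : derivable (id : 'rV[R]_n -> 'rV[R]_n) x v.
  exact: derivable_id.
exact: H.
Qed.

Lemma partial_coord (a b : 'I_n) :
  partial a (fun z : 'rV[R]_n => z 0 b) = cst (b == a)%:R.
Proof.
apply/funext => x; rewrite /partial.
have := derive_mx (@derivable_id R 'rV[R]_n x (delta_mx 0 a)).
rewrite derive_id => /(congr1 (fun M : 'rV[R]_n => M 0 b)).
by rewrite [in RHS]mxE => <-; rewrite mxE.
Qed.

Lemma smooth_coord (b : 'I_n) : smooth (fun z : 'rV[R]_n => z 0 b).
Proof.
apply: smooth_of_partials => [x|a x|a].
- exact: coord_continuous.
- exact: derivable_coord.
- by rewrite partial_coord; exact: smooth_cst.
Qed.

Lemma partial_coordM (a b c : 'I_n) :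
  partial a (fun z : 'rV[R]_n => z 0 b * z 0 c) =
  fun z => (c == a)%:R * z 0 b + (b == a)%:R * z 0 c.
Proof.
apply/funext => x; rewrite /partial.
rewrite (deriveM (@derivable_coord b x _) (@derivable_coord c x _)).
rewrite -!/(partial _ _ x) !partial_coord.
by congr (_ + _); rewrite mulrC.
Qed.

Lemma smooth_linear2 (r r' : R) (b c : 'I_n) :
  smooth (fun z : 'rV[R]_n => r * z 0 b + r' * z 0 c).
Proof.
apply: (smooth_comb r' (f := fun z => r * z 0 b)); last exact: smooth_coord.
have := smooth_comb r (smooth_cst 0) (smooth_coord b).
by congr smooth; apply/funext => z; rewrite /= add0r.
Qed.

Lemma partial_linear2 (r r' : R) (a b c : 'I_n) :
  partial a (fun z : 'rV[R]_n => r * z 0 b + r' * z 0 c) =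
  cst (r * (b == a)%:R + r' * (c == a)%:R).
Proof.
apply/funext => x; rewrite /partial.
rewrite (@deriveD _ _ _ (r *: (fun z : 'rV[R]_n => z 0 b))
   (r' *: (fun z : 'rV[R]_n => z 0 c))); last 2 first.
- by apply: derivableZ; exact: derivable_coord.
- by apply: derivableZ; exact: derivable_coord.
rewrite !deriveZ; try exact: derivable_coord.
by rewrite -!/(partial _ _ x) !partial_coord.
Qed.

Lemma smooth_coordM (b c : 'I_n) : smooth (fun z : 'rV[R]_n => z 0 b * z 0 c).
Proof.
apply: smooth_of_partials => [x|a x|a].
- exact: (cvgM (@coord_continuous R 1 n 0 b x) (@coord_continuous R 1 n 0 c x)).
- by apply: derivableM; exact: derivable_coord.
- by rewrite partial_coordM; exact: smooth_linear2.
Qed.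

Lemma smooth_sum_coord (I : Type) (r : seq I) (h : I -> 'I_n) :
  smooth (fun z : 'rV[R]_n => \sum_(i <- r) z 0 (h i)) /\
  forall a, partial a (fun z : 'rV[R]_n => \sum_(i <- r) z 0 (h i)) =
    cst (\sum_(i <- r) (h i == a)%:R).
Proof.
elim: r => [|i r [IHs IHp]].
  have E : (fun z : 'rV[R]_n => \sum_(i <- [::]) z 0 (h i)) = cst 0.
    by apply/funext => z; rewrite big_nil.
  by rewrite E; split=> [|a]; rewrite ?partial_cst ?big_nil //; exact: smooth_cst.
have E : (fun z : 'rV[R]_n => \sum_(j <- i :: r) z 0 (h j)) =
    (fun z => z 0 (h i) + 1 * \sum_(j <- r) z 0 (h j)).
  by apply/funext => z; rewrite big_cons mul1r.
rewrite E; split=> [|a].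
  by apply: smooth_comb; first exact: smooth_coord.
rewrite partial_comb.
- by rewrite partial_coord IHp; apply/funext => x; rewrite /= mul1r big_cons.
- by move=> x; exact: derivable_coord.
- by move=> x; exact: smooth_derivable.
Qed.

End Quadratic.

Section Genericity.
Variables (R : realType) (k : nat).
Local Notation pt := 'rV[R]_(1 + k + 1).
Local Notation jets := (pt * 'M[R]_(1 + k + 1))%type.

(* The perturbation making all nondegeneracy conditions hold: its 2-jet at the
   origin violates none of them. *)
Definition perturbation (z : pt) : R :=
  z 0 (var0 k) * z 0 (var0 k) + 1 *
  (z 0 (var0 k) * z 0 (var_lam k) + 1 * \sum_(i < k) z 0 (var_source i)).

Let sq := fun z : pt => z 0 (var0 k) * z 0 (var0 k).
Let mx := fun z : pt => z 0 (var0 k) * z 0 (var_lam k).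
Let sm := fun z : pt => \sum_(i < k) z 0 (var_source i).

Lemma smooth_perturbation : smooth perturbation.
Proof.
apply: (smooth_comb 1 (f := sq)); first exact: smooth_coordM.
apply: (smooth_comb 1 (f := mx)); first exact: smooth_coordM.
by have [] := smooth_sum_coord R (index_enum 'I_k) (@var_source k).
Qed.

Lemma partial_perturbation a : partial a perturbation = fun z =>
  ((var0 k == a)%:R * z 0 (var0 k) + (var0 k == a)%:R * z 0 (var0 k)) + 1 *
  (((var_lam k == a)%:R * z 0 (var0 k) + (var0 k == a)%:R * z 0 (var_lam k))
   + 1 * \sum_(i < k) (var_source i == a)%:R).
Proof.
have [s1 p1] := smooth_sum_coord R (index_enum 'I_k) (@var_source k).
rewrite (partial_comb (f := sq) (g := fun z => mx z + 1 * sm z)).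
- rewrite (partial_comb (f := mx) (g := sm)).
  + by rewrite !partial_coordM p1.
  + by move=> x; apply: smooth_derivable; exact: smooth_coordM.
  + by move=> x; exact: smooth_derivable.
- by move=> x; apply: smooth_derivable; exact: smooth_coordM.
- move=> x; apply: smooth_derivable.
  by apply: smooth_comb => //; exact: smooth_coordM.
Qed.

Lemma partial0_perturbation : partial (var0 k) perturbation = fun z =>
  2 * z 0 (var0 k) + 1 * z 0 (var_lam k).
Proof.
rewrite partial_perturbation; apply/funext => z.
have -> : \sum_(i < k) (var_source i == var0 k)%:R = 0 :> R.
  by apply: big1 => i _; rewrite (negbTE (var_source_neq0 i)).
by rewrite eqxx (negbTE (var_lam_neq0 k)) /=; ring.
Qed.

Lemma partial_source_perturbation i : partial (var_source i) perturbation 0 = 1.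
Proof.
rewrite partial_perturbation !mxE !mulr0 !addr0 add0r !mul1r.
rewrite (bigD1 i) //= eqxx big1 ?addr0 ?add0r // => j ji.
by rewrite (inj_eq (@var_source_inj k)) (negbTE ji).
Qed.

Lemma partial00_perturbation :
  partial (var0 k) (partial (var0 k) perturbation) 0 = 2.
Proof.
rewrite partial0_perturbation partial_linear2 eqxx (negbTE (var_lam_neq0 k)) /=.
by ring.
Qed.

Lemma partial_lam0_perturbation :
  partial (var_lam k) (partial (var0 k) perturbation) 0 = 1.
Proof.
rewrite partial0_perturbation partial_linear2 eqxx eq_sym.
by rewrite (negbTE (var_lam_neq0 k)) /=; ring.
Qed.

(** The monomials of the perturbation all vanish on the lambda-axis, and none of them is x_0
    itself. *)
Lemma V0_perturb f (e : R) : V0 R k f -> V0 R k (fun z => f z + e * perturbation z).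
Proof.
move=> [[sf f0] df0]; have sp := smooth_perturbation; split; first split.
- exact: smooth_comb.
- move=> lam; rewrite f0 /perturbation !pointE big1; last by move=> i _; rewrite pointE.
  by ring.
- rewrite partial_comb; try by move=> x; exact: smooth_derivable.
  by rewrite df0 partial0_perturbation !mxE; ring.
Qed.

Lemma jet2_perturb f (e : R) : smooth f ->
  jet2 (fun z => f z + e * perturbation z) = jet2 f + e *: jet2 perturbation.
Proof.
move=> sf; have sp := smooth_perturbation.
have H a g h : smooth g -> smooth h -> partial a (fun z : pt => g z + e * h z) =
    fun z => partial a g z + e * partial a h z.
  by move=> sg sh; rewrite partial_comb // => x; exact: smooth_derivable.
congr pair.
  by apply/rowP => a; rewrite !mxE H.
by apply/matrixP => a b; rewrite !mxE H // H //; exact: smooth_partial.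
Qed.

(** All nonempty [J] are listed because the lift, and with it the relevant [J], is chosen later.
    They are finitely many, so the set stays open. *)
Definition nondegenerate : set jets :=
  [set j : jets | [/\ j.2 (var0 k) (var0 k) != 0, j.2 (var_lam k) (var0 k) != 0 &
    forall J : {set 'I_k}, J != finset.set0 ->
      \sum_(i in J) j.1 0 (var_source i) != 0]].

Lemma open_nondegenerate : open nondegenerate.
Proof.
have c2 a b : continuous (fun i : jets => i.2 a b).
  move=> j; apply: (@cvg_comp _ _ _ snd (fun M : 'M[R]_(1 + k + 1) => M a b)).
    exact: cvg_snd.
  exact: coord_continuous.
have c1 b : continuous (fun i : jets => i.1 0 b).
  move=> j; apply: (@cvg_comp _ _ _ fst (fun M : pt => M 0 b)).
    exact: cvg_fst.
  exact: coord_continuous.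
rewrite openE => j [j0 jl jJ].
have n0 : \forall i \near j, (i : jets).2 (var0 k) (var0 k) != 0.
  exact: (@cvgr_neq0 _ _ _ _ (nbhs_filter j) _ _ (c2 _ _ j) j0).
have nl : \forall i \near j, (i : jets).2 (var_lam k) (var0 k) != 0.
  exact: (@cvgr_neq0 _ _ _ _ (nbhs_filter j) _ _ (c2 _ _ j) jl).
have nJ : \forall i \near j, forall J : {set 'I_k}, J != finset.set0 ->
    \sum_(a in J) (i : jets).1 0 (var_source a) != 0.
  apply: (@filter_forall _ _ _ _ (nbhs_filter j)) => J.
  have [->|J0] := eqVneq J finset.set0; first by near=> i.
  have cJ : \sum_(a in J) (i : jets).1 0 (var_source a) @[i --> j] -->
     \sum_(a in J) (j : jets).1 0 (var_source a).
    by apply: (cvg_big (@add_continuous R) (nbhs_filter _)) => a _; exact: (c1 _ j).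
  by near=> i => _; near: i; exact: (@cvgr_neq0 _ _ _ _ (nbhs_filter j) _ _ cJ (jJ J J0)).
rewrite /interior; near=> i; split; near: i; [exact: n0 | exact: nl | exact: nJ].
Unshelve. all: by end_near. Qed.

(** An affine function with nonzero slope has a single zero, which a punctured neighborhood of 0
    avoids. Each nondegeneracy condition on the perturbed jet is of this form in e. *)
Lemma near_affine_neq0 (a b : R) : b != 0 -> \forall e \near (0 : R)^', a + e * b != 0.
Proof.
move=> b0; have [->|a0] := eqVneq a 0.
  by near=> e; rewrite add0r mulf_neq0 //; near: e; exact: (@nbhs_dnbhs_neq R).
have c : a + e * b @[e --> (0 : R)] --> a + 0 * b.
  by apply: cvgD; [exact: cvg_cst | apply: cvgM; [exact: cvg_id | exact: cvg_cst]].
rewrite mul0r addr0 in c.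
have near0 : \forall e \near (0 : R), a + e * b != 0 by exact: (cvgr_neq0 _ c a0).
exact: nbhs_dnbhs near0.
Unshelve. all: by end_near. Qed.

Lemma nondegenerate_perturb f : V0 R k f ->
  \forall e \near (0 : R)^', nondegenerate (jet2 (fun z => f z + e * perturbation z)).
Proof.
move=> [[sf _] _].
have nJ : \forall e \near (0 : R)^', forall J : {set 'I_k}, J != finset.set0 ->
    \sum_(i in J) (jet2 f).1 0 (var_source i) +
      e * \sum_(i in J) (jet2 perturbation).1 0 (var_source i) != 0.
  apply: filter_forall => J; have [->|J0] := eqVneq J finset.set0.
    by near=> i.
  near=> e => _; near: e; apply: near_affine_neq0.
  rewrite (eq_bigr (fun=> 1)) => [|i _]; last first.
    by rewrite mxE partial_source_perturbation.
  by rewrite sumr_const -[1 *+ _]/(_%:R) pnatr_eq0 cards_eq0.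
near=> e; rewrite jet2_perturb //; split.
- rewrite !mxE partial00_perturbation; near: e; apply: near_affine_neq0.
  by rewrite pnatr_eq0.
- rewrite !mxE partial_lam0_perturbation; near: e; apply: near_affine_neq0.
  exact: oner_neq0.
- move=> J J0.
  rewrite (eq_bigr (fun i => (jet2 f).1 0 (var_source i) +
    e * (jet2 perturbation).1 0 (var_source i))); last by move=> i _; rewrite !mxE.
  rewrite big_split /= -mulr_sumr; move: J J0; near: e; exact: nJ.
Unshelve. all: by end_near. Qed.

(** For density, the jet of f is approached by the jets of f + e * [perturbation], which are
    realised in the class and nondegenerate for small e other than 0. *)
Lemma generically_nondegenerate (P : set (pt -> R)) :
  (forall f, V0 R k f -> nondegenerate (jet2 f) -> P f) -> generically (V0 R k) P.
Proof.
move=> H; exists (nondegenerate `&` (@jet2 R k @` V0 R k)); split.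
- by exists nondegenerate => //; exact: open_nondegenerate.
- move=> _ [f Vf <-] B nB.
  have c : jet2 f + e *: jet2 perturbation @[e --> (0 : R)] -->
      jet2 f + 0 *: jet2 perturbation.
    by apply: cvgD; [exact: cvg_cst | apply: cvgZ; [exact: cvg_id | exact: cvg_cst]].
  rewrite scale0r addr0 in c.
  have nB' : \forall e \near (0 : R)^', B (jet2 f + e *: jet2 perturbation).
    exact: nbhs_dnbhs (c _ nB).
  have [e [Be ne]] : exists e, B (jet2 f + e *: jet2 perturbation) /\
      nondegenerate (jet2 (fun z => f z + e * perturbation z)).
    apply: (@filter_ex _ ((0 : R)^')); near=> e; split; near: e; first exact: nB'.
    exact: nondegenerate_perturb.
  rewrite -jet2_perturb in Be; last by have [[]] := Vf.
  exists (jet2 (fun z => f z + e * perturbation z)); split=> //; split=> //.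
  by exists (fun z => f z + e * perturbation z) => //; exact: V0_perturb.
- by move=> f Vf [nf _]; exact: H.
Unshelve. all: by end_near. Qed.

End Genericity.

(** * Lifts inside a layer *)

Section Combinatorics.
Variable k : nat.

(** Colorings with quotient [N] are replaced by surjective morphisms onto [N], so that different
    colorings can be compared through their values in [N]. *)
Lemma quotient_morphism (N L : network k) (bt : equiv_rel L) :
  balanced bt -> network_eq N (quotient_network bt) ->
  exists psi : L -> N, [/\ forall i c, psi (source i c) = source i (psi c),
    forall n, exists c, psi c = n & forall c d, psi c = psi d <-> bt c d].
Proof.
move=> bal [phi [inv phiK invK] phiS].
have piP c d : \pi_{eq_quot bt}%qT c = \pi_{eq_quot bt}%qT d <-> bt c d.
  by split => [/eqmodP|/eqmodP].
exists (fun c => inv (\pi_{eq_quot bt}%qT c : quotient_network bt)); split.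
- move=> i c; apply: (can_inj phiK); rewrite invK phiS invK /=.
  (* The quotient computes sources at [repr]; balancedness leads back to c. *)
  by apply/piP/bal/piP; rewrite reprK.
- move=> n; exists (repr (phi n : {eq_quot bt}%qT)).
  by rewrite reprK phiK.
- move=> c d; rewrite -piP; split=> [|->//].
  exact: (can_inj invK).
Qed.

Section Layers.
Variables (N : network k) (m : nat) (C : nat -> {set N}).
Hypothesis ffN : feed_forward m C.

Lemma layer_unique c p q : (p <= m)%N -> (q <= m)%N ->
  c \in C p -> c \in C q -> p = q.
Proof.
move=> pm qm cp cq; apply/eqP; apply: contraT => /(ff_disjoint ffN pm qm) E.
by have := finset.in_set0 c; rewrite -E finset.inE cp cq.
Qed.

Lemma iter_source_layer i c p q : (p <= m)%N -> (q <= p)%N -> c \in C p ->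
  iter q (source i) c \in C (p - q)%N.
Proof.
move=> pm; elim: q => [|q IH] qp cp; first by rewrite subn0.
rewrite iterS; apply: (ff_source ffN); last first.
  by rewrite subnSK //; apply: IH => //; exact: ltnW.
by lia.
Qed.

Lemma source_positive_layer c p i : (p <= m)%N -> c \in C p ->
  source i c = c -> p = 0%N.
Proof.
case: p => // p pm cp E.
have := layer_unique (ltnW pm) pm (ff_source ffN i pm cp).
by rewrite E => /(_ cp) H; have := n_Sn p; rewrite -H.
Qed.

End Layers.

Variables (N L : network k) (m : nat) (C : nat -> {set N}) (C' : nat -> {set L}).
Hypotheses (ffN : feed_forward m C) (ffL : feed_forward m C').

(** It is not assumed that [psi] respects layers. A preimage of a top cell of [N] lies in some layer
    q of [L]. After q steps of type i it is fixed, hence so is its image in layer m - q, which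
    forces q = m. Descending m - p steps from both cells ends at u' and u. *)
Lemma morphism_singleton_layer (psi : L -> N) p u u' (i : 'I_k) :
  (forall i c, psi (source i c) = source i (psi c)) ->
  (forall n, exists c, psi c = n) -> (p <= m)%N ->
  C p = [set u]%SET -> C' p = [set u']%SET -> psi u' = u.
Proof.
move=> hom surj pm Cp C'p.
have homi q c : psi (iter q (source i) c) = iter q (source i) (psi c).
  by elim: q => //= q IH; rewrite hom IH.
have /set0Pn[t tm] := ff_nonempty ffN (leqnn m).
have [t' tE] := surj t; have [q qm t'q] := ff_cover ffL t'.
have qE : q = m.
  have w0 := iter_source_layer ffL i qm (leqnn q) t'q.
  rewrite subnn in w0.
  have wm := iter_source_layer ffN i (leqnn m) qm tm.
  have := source_positive_layer ffN (i := i) (leq_subr _ _) wm.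
  rewrite -tE -homi -hom (ff_fixed ffL) // => /(_ erefl) /eqP.
  by rewrite subn_eq0 => mq; apply/eqP; rewrite eqn_leq qm.
rewrite qE in t'q.
have := iter_source_layer ffL i (leqnn m) (leq_subr p m) t'q.
have := iter_source_layer ffN i (leqnn m) (leq_subr p m) tm.
rewrite subKn // Cp C'p !finset.inE => /eqP <- /eqP <-.
by rewrite homi tE.
Qed.

(* The unique cell of layer [j + 1] of [N] sees which edge types have the same
   source, so every quotient map identifies the same pair of cells. *)
Lemma lift_inside_inputs j : lift_inside m C' m C j -> (j < m)%N ->
  #|C j.+1| = 1%N ->
  exists u' (i i' : 'I_k), [/\ C' j.+1 = [set u']%SET,
    source i u' <> source i' u' &
    forall bt : equiv_rel L, balanced bt ->
      network_eq N (quotient_network bt) -> bt (source i u') (source i' u')].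
Proof.
move=> [[bt0 bal0 eq0] _ cj ci] jm Cj1.
have C'j1 : #|C' j.+1| = 1%N by rewrite ci //; lia.
have /cards1P[u Cu] : #|C j.+1| == 1%N by rewrite Cj1.
have /cards1P[u' C'u] : #|C' j.+1| == 1%N by rewrite C'j1.
have Cin c : c \in C j <-> exists i, c = source i u.
  split=> [cC|[i ->]].
    have [c' + [i cE]] := ff_feeds ffN jm cC.
    by rewrite Cu finset.inE => /eqP uE; exists i; rewrite cE uE.
  by apply: (ff_source ffN) => //; rewrite Cu finset.inE.
have C'in c : c \in C' j <-> exists i, c = source i u'.
  split=> [cC|[i ->]].
    have [c' + [i cE]] := ff_feeds ffL jm cC.
    by rewrite C'u finset.inE => /eqP uE; exists i; rewrite cE uE.
  by apply: (ff_source ffL) => //; rewrite C'u finset.inE.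
(* This provides an edge type along which [morphism_singleton_layer] can descend. *)
have /set0Pn[c0 /Cin[i0 _]] := ff_nonempty ffN (ltnW jm).
have psiu bt : balanced bt -> network_eq N (quotient_network bt) ->
    exists psi : L -> N, [/\ forall i c, psi (source i c) = source i (psi c),
      forall c d, psi c = psi d <-> bt c d & psi u' = u].
  move=> bal eqN; have [psi [hom surj ker]] := quotient_morphism bal eqN.
  exists psi; split=> //.
  exact: (morphism_singleton_layer i0 hom surj jm Cu C'u).
have [psi [hom ker psiE]] := psiu bt0 bal0 eq0.
have [i [i' [ne eqs]]] : exists i i', source i u' <> source i' u' /\
    source i u = source i' u.
  (* Without such a pair [psi] would map [C' j] bijectively onto [C j], against their different
     cardinalities. *)
  apply: contrapT => H; apply: cj.
  rewrite (_ : C j = [set psi c | c in C' j]%SET).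
    apply/esym/card_in_imset => c d /C'in[i ->] /C'in[i' ->].
    rewrite !hom psiE => E; apply: contrapT => ne; apply: H.
    by exists i, i'.
  apply/setP => c; apply/idP/imsetP => [/Cin[i ->]|[d /C'in[i ->] ->]].
    by exists (source i u'); [apply/C'in; exists i | rewrite hom psiE].
  by apply/Cin; exists i; rewrite hom psiE.
exists u', i, i'; split=> // bt bal eqN.
have [psi' [hom' ker' psi'E]] := psiu bt bal eqN.
by apply/ker'; rewrite !hom' psi'E.
Qed.

End Combinatorics.

(** * Germs and the branch *)

Section Germs.
Variables (R : realType) (k : nat) (f : 'rV[R]_(1 + k + 1) -> R) (L : network k).
Variable c0 : L.
Implicit Types b : equilibrium_branch f L.

(** Mere nonvanishing on one side says nothing about the other side of a two-sided branch. A linear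
    bound does, since it forces a nonzero derivative at 0. *)
Definition grows_linearly b : Prop := exists kap d : R,
  [/\ 0 < kap, 0 < d &
    forall t, bdom b t -> `|t| < d -> kap * `|t| <= `|bval b t c0|].

Lemma half_domain_small (tau l t : R) : half_domain tau l t -> tau * tau = 1 ->
  `|t| < l.
Proof.
move=> /andP[t0 tl] tau2.
by rewrite -[`|t|]mul1r -(norm_sign tau2) -normrM ger0_norm.
Qed.

(** A domain meeting one side of 0 contains a whole half-interval there. Either it has no points on
    the other side, or the branch is two-sided and smooth at 0. *)
Lemma branch_domain_side b t0 : bdom b t0 -> t0 != 0 ->
  (exists2 l : R, 0 < l & half_domain (Num.sg t0) l `<=` bdom b) /\
  ((forall t, bdom b t -> 0 <= Num.sg t0 * t) \/
   derivable (fun t => bval b t c0) 0 1).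
Proof.
move=> Dt t0n; case: (bregular b) => l l0 [[DE sm]|[DE _]].
- split; last first.
    by right; apply: (sm c0 0%N 0); rewrite DE /= in_itv /= oppr_lt0 l0.
  exists l => // t ht; have := half_domain_small ht (sgr_sqr t0n).
  by rewrite DE /= in_itv /= ltr_norml.
- case: DE => DE; rewrite DE /= in_itv /= in Dt; move/andP: Dt => [Dl Dr].
    have t0_lt : t0 < 0 by rewrite lt_neqAle t0n.
    rewrite ltr0_sg //; split.
      exists l => // t; rewrite /half_domain /= mulN1r DE /= in_itv /=.
      by rewrite oppr_ge0 ltrNl andbC.
    by left=> t; rewrite DE /= in_itv /= mulN1r oppr_ge0 => /andP[].
  have t0_gt : 0 < t0 by rewrite lt_neqAle eq_sym t0n.
  rewrite gtr0_sg //; split.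
    by exists l => // t; rewrite /half_domain /= mul1r DE /= in_itv.
  by left=> t; rewrite DE /= in_itv /= mul1r => /andP[].
Qed.

Lemma side_point (tau l e : R) : tau * tau = 1 -> 0 < l -> 0 < e ->
  exists t, [/\ side tau l t, `|t| < e & 0 < `|t|].
Proof.
move=> tau2 l0 e0; have m0 : 0 < Num.min l e by rewrite lt_min l0 e0.
have ml : Num.min l e <= l by rewrite ge_min lexx.
have me : Num.min l e <= e by rewrite ge_min lexx orbT.
exists (tau * (Num.min l e / 2)); rewrite normrM (norm_sign tau2) mul1r.
rewrite /side /= mulrA tau2 mul1r gtr0_norm ?divr_gt0 //.
by split=> //; [apply/andP; split; lra | lra].
Qed.

(* A one-sided branch may be continued to the other side through a two-sided
   one, whose derivative at 0 then transports the lower bound. *)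
Lemma grows_linearly_related b1 b2 :
  branch_related b1 b2 -> grows_linearly b1 -> grows_linearly b2.
Proof.
move=> [U [oU U0 Une Ueq]] [kap [d [kap0 d0 g1]]].
have [t0 [[Ut0 D1t0] D2t0] t0n] : exists2 t0 : R,
    (U `&` bdom b1 `&` bdom b2) t0 & t0 != 0.
  apply: contrapT => H; apply: Une; apply/seteqP; split=> t.
    by move=> Ht; apply: contrapT => tn; apply: H; exists t => //; exact/eqP.
  move=> /= ->; have zero b : bdom b 0.
    case: (bregular b) => l l0 [[-> _]|[[->|->] _]];
      by rewrite /= in_itv /= ?oppr_lt0 ?lexx ?l0.
  by split; [split|]; [exact: U0 | exact: zero | exact: zero].
have [[l1 l10 sub1] _] := branch_domain_side D1t0 t0n.
have [[l2 l20 sub2] alt] := branch_domain_side D2t0 t0n.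
have sg2 := sgr_sqr t0n; set tau := Num.sg t0 in sub1 sub2 alt sg2.
have /nbhs_ballP[r /= r0 rU] : nbhs (0 : R) U by exact: open_nbhs_nbhs.
pose e := Num.min (Num.min l1 l2) (Num.min r d).
have e0 : 0 < e by rewrite !lt_min l10 l20 r0 d0.
have low t : half_domain tau e t -> kap * `|t| <= `|bval b2 t c0|.
  move=> ht; have te := half_domain_small ht sg2.
  have /andP[ht0 hte] := ht.
  have D1t : bdom b1 t.
    by apply: sub1; rewrite /half_domain /= ht0 (lt_le_trans hte) // !ge_min lexx.
  have D2t : bdom b2 t.
    by apply: sub2; rewrite /half_domain /= ht0 (lt_le_trans hte) // !ge_min lexx orbT.
  rewrite -(Ueq t _ D1t D2t).
    by apply: g1 => //; apply: lt_le_trans te _; rewrite !ge_min lexx !orbT.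
  apply: rU; rewrite -ball_normE /= sub0r normrN; apply: lt_le_trans te _.
  by rewrite !ge_min lexx !orbT.
case: alt => [onesided|der].
  exists kap, e; split=> // t D2t te; apply: low.
  rewrite /half_domain /= onesided //= -[_ * _]ger0_norm ?onesided //.
  by rewrite normrM (norm_sign sg2) mul1r.
pose q (h : R) := `|h^-1 *: (bval b2 (h *: 1 + 0) c0 - bval b2 0 c0)|.
have qE h : h != 0 -> `|bval b2 h c0| = q h * `|h|.
  move=> h0; rewrite /q addr0 -[h *: 1]/(h * 1) mulr1 (bzero b2) subr0.
  by rewrite normrM mulrAC -normrM mulVf // normr1 mul1r.
have [D qD] : exists D : R, q h @[h --> 0^'] --> D.
  by exists `|'D_1 (fun t => bval b2 t c0) 0|; exact: (cvg_norm der).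
have near_ball (P : R -> Prop) : (\forall h \near (0 : R)^', P h) ->
    exists2 r', 0 < r' & forall h, `|h| < r' -> h != 0 -> P h.
  rewrite near_withinE => /nbhs_ballP[r' /= r'0 rP]; exists r' => // h hr hn.
  by apply: rP => //; rewrite -ball_normE /= sub0r normrN.
(* On the common side the quotients are at least kap, so their limit D is too. Being a two-sided
   limit, it bounds the quotients below by kap / 2 on both sides. *)
have kD : kap <= D.
  rewrite leNgt; apply/negP => Dk.
  have /near_ball[r' r'0 r'P] : \forall h \near (0 : R)^', q h < kap.
    exact: (cvgr_lt _ qD).
  have [h [sh hr h0]] := side_point sg2 e0 r'0.
  have hn : h != 0 by rewrite -normr_gt0.
  have := low h (side_half_domain sh).
  by rewrite qE // ler_pM2r // leNgt r'P.
have /near_ball[r' r'0 r'P] : \forall h \near (0 : R)^', kap / 2 < q h.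
  by apply: (cvgr_gt _ qD); apply: lt_le_trans kD; lra.
exists (kap / 2), r'; split=> //; first exact: divr_gt0.
move=> t D2t tr; have [->|tn] := eqVneq t 0; first by rewrite normr0 mulr0.
by rewrite qE // ler_pM2r ?normr_gt0 // ltW // r'P.
Qed.

Lemma grows_linearly_bifurcation b : grows_linearly b -> bifurcation_branch b.
Proof.
move=> gb [b0 geq triv].
have : grows_linearly b0.
  elim: geq gb => [x y|x y z _ IH1 _ IH2 gx]; first exact: grows_linearly_related.
  by apply: IH2; exact: IH1.
move=> [kap [d [kap0 d0 g0]]].
have [t [Dt td t0]] : exists t, [/\ bdom b0 t, `|t| < d & 0 < `|t|].
  case: (bregular b0) => l l0 DE.
  have one2 : (1 : R) * 1 = 1 by rewrite mulr1.
  have mone2 : (-1 : R) * -1 = 1 by rewrite mulrNN mulr1.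
  have [t [st td t0]] := side_point one2 l0 d0.
  have [s [ss sd s0]] := side_point mone2 l0 d0.
  move: st ss; rewrite /side /= mul1r mulN1r oppr_gt0 => /andP[t1 t2] /andP[s1 s2].
  case: DE => [[DE _]|[[DE|DE] _]].
  - by exists t; split=> //; rewrite DE /= in_itv /= t2 (lt_trans _ t1) // oppr_lt0.
  - by exists s; split=> //; rewrite DE /= in_itv /= (ltW s1) andbT ltrNl.
  - by exists t; split=> //; rewrite DE /= in_itv /= t2 (ltW t1).
have := g0 t Dt td; rewrite triv // normr0 leNgt => /negP; apply.
exact: mulr_gt0.
Qed.

End Germs.

(** * The branch on the lift *)

Section Realization.
Variables (R : realType) (k : nat) (f : 'rV[R]_(1 + k + 1) -> R).
Variables (L : network k) (m : nat) (C' : nat -> {set L}).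
Hypotheses (ffL : feed_forward m C').
Hypothesis f0 : forall lam, f (point 0 (fun=> 0) lam) = 0.
Variables (j : nat) (u c0 : L) (J : {set 'I_k}).
Hypotheses (j0 : (0 < j)%N) (jm : (j < m)%N) (Cj1 : C' j.+1 = [set u]%SET).
Hypothesis c0j : c0 \in C' j.
Hypothesis Jdef : forall i, (i \in J) = (source i u == c0).
Variables (tau l kap : R) (s : R -> R) (y : nat -> R -> R).
Hypotheses (tau2 : tau * tau = 1) (l0 : 0 < l) (kap0 : 0 < kap).
Hypothesis chain : layer_chain f J tau l kap (m - j.+1) s y.

Lemma chain_branch : exists b : equilibrium_branch f L,
  [/\ bifurcation_branch b, forall t, side tau l t -> bdom b t,
      forall t, side tau l t -> kap * `|t| <= `|bval b t c0| &
      forall t d, d \in C' j -> d != c0 -> bval b t d = 0].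
Proof.
have [gs gy eqs] := chain.
have /choice[lay layP] c : exists p, (p <= m)%N /\ c \in C' p.
  by have [p pm cp] := ff_cover ffL c; exists p.
have layE c p : (p <= m)%N -> c \in C' p -> lay c = p.
  by move=> pm cp; have [lm lc] := layP c; exact: (layer_unique ffL lm pm lc).
pose g c : R -> R := if (lay c < j)%N then fun=> 0
  else if lay c == j then (if c == c0 then s else fun=> 0)
  else y (lay c - j.+1)%N.
pose val t c := zero_at0 (g c) t.
have gH c : half_germ tau l (g c).
  rewrite /g; case: ifP => _; first exact: half_germ_cst0.
  case: ifP => _; first by case: ifP => _ //; exact: half_germ_cst0.
  by apply: gy; apply: leq_sub2r; have [] := layP c.
have reg : branch_regular (half_domain tau l) val.
  exists l => //; right; split; first exact: half_domainE.
  by move=> c; exact: half_germ_regular.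
have val0 c : val 0 c = 0 by rewrite /val /zero_at0 eqxx.
have equil t : half_domain tau l t -> forall c, vector_field f (val t) t c = 0.
  move=> ht c; rewrite /vector_field; have [t0|tn] := eqVneq t 0.
    rewrite {}t0 val0; under [X in point _ X _]eq_fun do rewrite val0.
    exact: f0.
  have valE d : val t d = g d t by rewrite /val /zero_at0 (negbTE tn).
  have st : side tau l t := half_domainP tau2 ht tn.
  have [_ fs fu fy] := eqs t st.
  under [X in point _ X _]eq_fun do rewrite valE.
  rewrite valE; have [lm lc] := layP c.
  have srcE p i : lay c = p.+1 -> lay (source i c) = p.
    move=> E; rewrite E in lm lc.
    by apply: layE; [exact: ltnW | exact: (ff_source ffL)].
  (* A cell of layer 0 is its own source, and its value is 0 because 0 < j. *)
  have low i : (lay c <= j)%N -> g (source i c) t = 0.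
    move=> cj; rewrite /g ifT //; case E : (lay c) => [|p].
      by rewrite (ff_fixed ffL) ?E // -E.
    by rewrite (srcE p) // -E.
  case: (ltngtP (lay c) j) => cj.
  - under [X in point _ X _]eq_fun do rewrite (low _ (ltnW cj)).
    by rewrite /g cj.
  - case: (ltngtP (lay c) j.+1) => cj1; first by rewrite ltnS leqNgt cj in cj1.
      have [r rE] : exists r, lay c = (j.+1 + r).+1.
        by exists (lay c - j.+2)%N; lia.
      have inp i : g (source i c) t = y r t.
        rewrite /g (srcE (j.+1 + r)%N) // addKn.
        by rewrite ifF ?ifF //; lia.
      under [X in point _ X _]eq_fun do rewrite inp.
      rewrite /g ltnNge (ltnW cj) /= gtn_eqF // rE -addnS addKn.
      by apply: fy; lia.
    have cu : c = u by move: lc; rewrite cj1 Cj1 finset.inE => /eqP.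
    have inp i : g (source i c) t = inputs J (s t) i.
      rewrite /g (srcE j) // ltnn eqxx /inputs Jdef cu.
      by case: ifP.
    under [X in point _ X _]eq_fun do rewrite inp.
    by rewrite /g cj1 ltnNge leqnSn /= gtn_eqF // subnn.
  - have cj' : (lay c <= j)%N by rewrite cj.
    under [X in point _ X _]eq_fun do rewrite (low _ cj').
    by rewrite /g cj ltnn eqxx; case: ifP.
have valc0 t : side tau l t -> val t c0 = s t.
  move=> /andP[t0 _]; rewrite /val /zero_at0 ifF; last first.
    by apply: contraTF t0 => /eqP ->; rewrite mulr0 ltxx.
  by rewrite /g (layE _ _ (ltnW jm) c0j) ltnn !eqxx.
exists (EquilibriumBranch reg val0 equil); split=> /=.
- apply: (@grows_linearly_bifurcation _ _ _ _ c0); exists kap, l.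
  split=> //= t ht _; have [->|tn] := eqVneq t 0; first by rewrite normr0 mulr0.
  have st := half_domainP tau2 ht tn.
  by rewrite valc0 //; have [] := eqs t st.
- by move=> t st; exact: side_half_domain.
- by move=> t st; rewrite valc0 //; have [] := eqs t st.
- move=> t d dj dc0; rewrite /val /zero_at0; case: ifP => // _.
  by rewrite /g (layE _ _ (ltnW jm) dj) ltnn eqxx (negbTE dc0).
Qed.

End Realization.

Theorem proposition6p4 (R : realType) (k : nat) (N : network k) (m : nat)
    (C : nat -> {set N}) (HN : feed_forward m C) :
  generically (V0 R k) (fun f =>
    forall (L : network k) (n : nat) (C' : nat -> {set L}) (j : nat),
      feed_forward n C' -> lift_inside n C' m C j ->
      (0 < j < m)%N -> #|C j.+1| = 1%N ->
      exists b : equilibrium_branch f L,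
        bifurcation_branch b /\ ~ lifted_from N b).
Proof.
apply: generically_nondegenerate => f [[sf f0] df0] [ndd ndl ndS].
move=> L n C' j ffL lift /andP[j0 jm] Cj1.
have mn : m = n by case: lift.
move: ffL lift; rewrite -{n}mn => ffL lift.
have [u [i [i' [C'u ne same]]]] := lift_inside_inputs HN ffL lift jm Cj1.
(* The cell c0 is one of the two that every quotient map identifies. The type i makes both [J] and
   the set of all types nonempty, as the two slope conditions require. *)
pose c0 := source i u; pose J := [set a | source a u == c0]%SET.
have slopeE (K : {set 'I_k}) : K != finset.set0 -> slope f K 0 != 0.
  by move=> /ndS; rewrite /slope; under eq_bigr do rewrite mxE.
have J0 : J != finset.set0.
  by apply/set0Pn; exists i; rewrite finset.inE.
have T0 : [set: 'I_k]%SET != finset.set0.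
  by apply/set0Pn; exists i; rewrite finset.inE.
rewrite !mxE in ndd ndl.
have [tau tau2 /(_ (m - j.+1)%N)[l [kap [s [y [l0 kap0 ch]]]]]] :=
  exists_layer_chain sf f0 df0 ndd ndl (slopeE J J0) (slopeE _ T0).
have uj a : source a u \in C' j.
  by apply: (ff_source ffL) => //; rewrite C'u finset.inE.
have Jdef a : (a \in J) = (source a u == c0) by rewrite finset.inE.
have [b [bif dom bc0 bd]] :=
  chain_branch ffL f0 j0 jm C'u (uj i) Jdef tau2 l0 kap0 ch.
exists b; split=> // -[bt [bal eqN]].
rewrite /in_polydiagonal => /nbhs_ballP[e /= e0 eP].
have [t [st te t0]] := side_point tau2 l0 e0.
have := eP t; rewrite -ball_normE /= sub0r normrN => /(_ te (dom t st)).
move=> /(_ _ _ (same bt bal eqN)) E.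
(* The coloring gives c0 the value of its partner, which is 0, against the lower bound at t. *)
have := bc0 t st; rewrite E (bd t _ (uj i')); last by apply/eqP => H; exact: ne.
by rewrite normr0 leNgt mulr_gt0.
Qed.
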